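(* Let $R$ be a $\tau_q$-Noetherian ring. Then $$\tau_q\text{-gl.dim}(R)=\tau_q\text{-gl.dim}(R[x])=\mathrm{gl.dim}(\mathrm{T}(R[x])),$$ where $\mathrm{T}(R[x])$ is the total ring of quotients of the polynomial ring $R[x]$ and $\mathrm{gl.dim}$ is the usual global dimension.
   Context: All rings are commutative with identity. An ideal $I$ of a ring $R$ is dense if $(0:_R I)=\{r\in R: Ir=0\}=0$, and semi-regular if it contains a finitely generated dense ideal. $\mathcal{Q}$ denotes the set of finitely generated semi-regular ideals of $R$. For an $R$-module $M$ let $\mathrm{tor}_{\mathcal Q}(M)=\{m\in M: Im=0\text{ for some }I\in\mathcal Q\}$; $M$ is $\mathcal Q$-torsion if $\mathrm{tor}_{\mathcal Q}(M)=M$ and $\mathcal Q$-torsion-free if $\mathrm{tor}_{\mathcal Q}(M)=0$. A $\mathcal Q$-torsion-free module $N$ is strongly Lucas if $\mathrm{Ext}_R^n(R/I,N)=0$ for all $I\in\mathcal Q$ and all $n\ge 1$. An $R$-module $P$ is $\tau_q$-projective if $\mathrm{Ext}^1_R(P,N)=0$ for every strongly Lucas $R$-module $N$. The $\tau_q$-projective dimension $\tau_q\text{-pd}_R(M)$ of an $R$-module $M$ is the least $n\geq 0$ such that there is an exact sequence $0\to P_n\to\cdots\to P_1\to P_0\to M\to 0$ with all $P_i$ $\tau_q$-projective ($\infty$ if none exists). The $\tau_q$-global dimension is $\tau_q\text{-gl.dim}(R)=\sup\{\tau_q\text{-pd}_R(M): M\text{ an }R\text{-module}\}$. An $R$-module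 $M$ is $\tau_q$-finitely generated if there is a homomorphism $F\to M$ with $F$ finitely generated free and $\mathcal Q$-torsion cokernel. $R$ is $\tau_q$-Noetherian if every ideal of $R$ is $\tau_q$-finitely generated. All these notions for $R[x]$ are taken with $R[x]$ in place of $R$. *)

(* Defs.v *)
From HB Require Import structures.
From mathcomp Require Import all_boot all_order all_algebra.
From mathcomp Require Import boolp ring.

Set Implicit Arguments.
Unset Strict Implicit.
Unset Printing Implicit Defensive.

Import GRing.Theory.
Local Open Scope ring_scope.
Local Open Scope quotient_scope.

(* None stands for infinity. *)
Definition enat := option nat.

Definition enat_le (a b : enat) : Prop :=
  match a, b with
  | _, None => True
  | None, Some _ => False
  | Some m, Some n => (m <= n)%N
  end.

Definition enat_least (P : nat -> Prop) : enat :=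
  match pselect (exists n, `[< P n >]) with
  | left exP => Some (ex_minn exP)
  | right _ => None
  end.

(* The supremum in enat: the least finite upper bound, and infinity when there
   is no finite upper bound. *)
Definition enat_sup (A : enat -> Prop) : enat :=
  enat_least (fun n => forall a, A a -> enat_le a (Some n)).

(* Unlike the library's idealr, the unit ideal is allowed. *)
Notation ideal R := (submodClosed R^o).

Section SubmoduleModule.
Variables (R : pzRingType) (V : lmodType R) (S : submodClosed V).

Record submod_carrier := SubmodCarrier {
  submod_val :> V;
  _ : submod_val \in (S : {pred V})
}.

HB.instance Definition _ := [isSub for submod_val].
HB.instance Definition _ := [Choice of submod_carrier by <:].
HB.instance Definition _ := [SubChoice_isSubLmodule of submod_carrier by <:].
End SubmoduleModule.

Section QuotientModule.
Variables (R : pzRingType) (V : lmodType R) (S : submodClosed V).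

Definition submod_equiv (x y : V) : bool := x - y \in S.

Fact submod_equiv_is_equiv : equiv_class_of submod_equiv.
Proof.
have [S0 SL] := submodClosedP S.
split=> [x|x y|y x z]; rewrite /submod_equiv ?subrr //.
  by apply/idP/idP => /(rpredZ (-1)); rewrite /submod_equiv scaleN1r opprB.
by move=> xy yz; rewrite -[x](subrK y) -addrA rpredD.
Qed.

Canonical submod_equiv_equiv := EquivRelPack submod_equiv_is_equiv.
Canonical submod_encModRel := defaultEncModRel submod_equiv.

Definition quot_module := {eq_quot submod_equiv}.
HB.instance Definition _ : EqQuotient V submod_equiv quot_module :=
  EqQuotient.on quot_module.
HB.instance Definition _ := Choice.on quot_module.

Local Notation proj := (\pi_quot_module).

Lemma quot_eqE (x y : V) : (proj x == proj y) = (x - y \in S).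
Proof. by rewrite piE. Qed.

Lemma repr_equiv (x : V) : repr (proj x) - x \in S.
Proof. by rewrite -quot_eqE reprK. Qed.

Definition quot_zero : quot_module := lift_cst quot_module 0.
Definition quot_add := lift_op2 quot_module +%R.
Definition quot_opp := lift_op1 quot_module -%R.
Definition quot_scale (a : R) := lift_op1 quot_module ( *:%R a).

Canonical pi_quot_zero := PiConst quot_zero.

Lemma pi_quot_add : {morph \pi : x y / x + y >-> quot_add x y}.
Proof.
move=> x y; unlock quot_add; apply/esym/eqP.
by rewrite quot_eqE opprD addrACA rpredD ?repr_equiv.
Qed.
Canonical pi_quot_add_morph := PiMorph2 pi_quot_add.

Lemma pi_quot_scale a : {morph \pi : x / a *: x >-> quot_scale a x}.
Proof.
move=> x; unlock quot_scale; apply/esym/eqP.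
by rewrite quot_eqE -scalerBr rpredZ ?repr_equiv.
Qed.
Canonical pi_quot_scale_morph a := PiMorph1 (pi_quot_scale a).

Lemma pi_quot_opp : {morph \pi : x / - x >-> quot_opp x}.
Proof.
move=> x; unlock quot_opp; apply/esym/eqP.
by rewrite quot_eqE -opprD -[- (_ + _)]scaleN1r rpredZ ?repr_equiv.
Qed.
Canonical pi_quot_opp_morph := PiMorph1 pi_quot_opp.

Fact quot_addA : associative quot_add.
Proof. by move=> x y z; rewrite -[x]reprK -[y]reprK -[z]reprK !piE addrA. Qed.

Fact quot_addC : commutative quot_add.
Proof. by move=> x y; rewrite -[x]reprK -[y]reprK !piE addrC. Qed.

Fact quot_add0 : left_id quot_zero quot_add.
Proof. by move=> x; rewrite -[x]reprK !piE add0r. Qed.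

Fact quot_addN : left_inverse quot_zero quot_opp quot_add.
Proof. by move=> x; rewrite -[x]reprK !piE addNr. Qed.

HB.instance Definition _ :=
  GRing.isZmodule.Build quot_module quot_addA quot_addC quot_add0 quot_addN.

Fact quot_scalerA a b x :
  quot_scale a (quot_scale b x) = quot_scale (a * b) x.
Proof. by rewrite -[x]reprK !piE scalerA. Qed.

Fact quot_scale1r : left_id 1 quot_scale.
Proof. by move=> x; rewrite -[x]reprK !piE scale1r. Qed.

Fact quot_scalerDr : right_distributive quot_scale +%R.
Proof.
move=> a x y; rewrite -[x]reprK -[y]reprK -[LHS]/(quot_scale a (quot_add _ _)).
by rewrite -[RHS]/(quot_add _ _) !piE scalerDr.
Qed.

Fact quot_scalerDl x : {morph quot_scale^~ x : a b / a + b}.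
Proof.
move=> a b; rewrite -[x]reprK -[RHS]/(quot_add _ _) !piE.
by rewrite scalerDl.
Qed.

HB.instance Definition _ := GRing.Zmodule_isLmodule.Build R quot_module
  quot_scalerA quot_scale1r quot_scalerDr quot_scalerDl.
End QuotientModule.

Section Cokernel.
Variables (R : pzRingType) (U V : lmodType R) (f : {linear U -> V}).

Definition image_pred : {pred V} := [pred y | `[< exists x, f x = y >]].

Fact image_pred_submod : GRing.subsemimod_closed image_pred.
Proof.
split; [split|].
- by apply/asboolP; exists 0; rewrite linear0.
- move=> x y /asboolP[a <-] /asboolP[b <-].
  by apply/asboolP; exists (a + b); rewrite linearD.
- move=> c x /asboolP[a <-].
  by apply/asboolP; exists (c *: a); rewrite linearZ.
Qed.
HB.instance Definition _ :=
  GRing.isSubmodClosed.Build R V image_pred image_pred_submod.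

Definition cokernel : lmodType R := quot_module image_pred.
End Cokernel.

Section Homological.
Variable R : comNzRingType.

Definition projective (P : lmodType R) : Prop :=
  forall (A B : lmodType R) (g : {linear A -> B}) (f : {linear P -> B}),
    (forall b, exists a, g a = b) ->
    exists h : {linear P -> A}, forall x, g (h x) = f x.

(* An exact sequence ... -> P_2 -> P_1 -> P_0 -> M -> 0. *)
Record resolution (M : lmodType R) := Resolution {
  res_obj :> nat -> lmodType R;
  res_diff : forall i, {linear res_obj i.+1 -> res_obj i};
  res_aug : {linear res_obj 0%N -> M};
  res_aug_surj : forall m, exists x, res_aug x = m;
  res_exact0 : forall x, res_aug x = 0 <-> exists y, res_diff 0%N y = x;
  res_exact : forall i x, res_diff i x = 0 <-> exists y, res_diff i.+1 y = x
}.

Section Ext.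
Variables (M N : lmodType R) (P : resolution M).

(* The cochain complex Hom(P_0, N) -> Hom(P_1, N) -> ... *)
Definition cocycle (n : nat) (f : {linear P n -> N}) : Prop :=
  forall x, f (res_diff P n x) = 0.

Definition coboundary (n : nat) : {linear P n -> N} -> Prop :=
  match n with
  | 0 => fun f => forall x, f x = 0
  | k.+1 => fun f =>
      exists g : {linear P k -> N}, forall x, f x = g (res_diff P k x)
  end.
End Ext.

(* Ext^n(M, N) = H^n(Hom(P, N)) for a projective resolution P of M. Such a P
   exists for every M and the choice of P is immaterial. *)
Definition Ext_zero (n : nat) (M N : lmodType R) : Prop :=
  forall P : resolution M, (forall i, projective (P i)) ->
  forall f : {linear P n -> N}, cocycle f -> coboundary f.

(* An exact sequence 0 -> P_n -> ... -> P_0 -> M -> 0 is a resolution whose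
   terms of index greater than n are zero. *)
Definition has_finite_resolution (X : lmodType R -> Prop) (M : lmodType R)
    (n : nat) : Prop :=
  exists P : resolution M,
    (forall i, (i <= n)%N -> X (P i)) /\
    (forall i, (n < i)%N -> forall x : P i, x = 0).

Definition dim_wrt (X : lmodType R -> Prop) (M : lmodType R) : enat :=
  enat_least (has_finite_resolution X M).

Definition gldim_wrt (X : lmodType R -> Prop) : enat :=
  enat_sup (fun d => exists M : lmodType R, d = dim_wrt X M).

Definition pd (M : lmodType R) : enat := dim_wrt projective M.
Definition gldim : enat := gldim_wrt projective.
End Homological.

Section TauQ.
Variable R : comNzRingType.

Definition fg_ideal (I : ideal R) : Prop :=
  exists (n : nat) (a : 'I_n -> R),
    forall x : R, x \in I <-> exists c : 'I_n -> R, x = \sum_i c i * a i.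

Definition dense_ideal (I : ideal R) : Prop :=
  forall r : R, (forall x : R, x \in I -> x * r = 0) -> r = 0.

Definition semiregular_ideal (I : ideal R) : Prop :=
  exists J : ideal R,
    [/\ fg_ideal J, dense_ideal J & forall x : R, x \in J -> x \in I].

Definition Qideal (I : ideal R) : Prop := fg_ideal I /\ semiregular_ideal I.

Definition torQ (M : lmodType R) (m : M) : Prop :=
  exists2 I : ideal R, Qideal I & forall a : R, a \in I -> a *: m = 0.

Definition Qtorsion (M : lmodType R) : Prop := forall m : M, torQ m.

Definition Qtorsion_free (M : lmodType R) : Prop :=
  forall m : M, torQ m -> m = 0.

Definition strongly_Lucas (N : lmodType R) : Prop :=
  Qtorsion_free N /\
  forall I : ideal R, Qideal I ->
  forall n : nat, (1 <= n)%N -> Ext_zero n (quot_module I) N.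

Definition tauq_projective (P : lmodType R) : Prop :=
  forall N : lmodType R, strongly_Lucas N -> Ext_zero 1 P N.

Definition tauq_pd (M : lmodType R) : enat := dim_wrt tauq_projective M.
Definition tauq_gldim : enat := gldim_wrt tauq_projective.

Definition tauq_fg (M : lmodType R) : Prop :=
  exists (n : nat) (f : {linear 'rV[R]_n -> M}), Qtorsion (cokernel f).

Definition tauq_Noetherian : Prop :=
  forall I : ideal R, tauq_fg (submod_carrier I).
End TauQ.

(* The total ring of quotients: classes of pairs (a, s) with s regular. As the
   denominators are regular, (a, s) ~ (b, t) amounts to a * t = b * s. *)
Module TotalQuotient.
Section TotalQuotient.
Variable R : comNzRingType.

Record fraction := Fraction {
  numden : R * R;
  _ : `[< GRing.lreg numden.2 >]
}.
HB.instance Definition _ := [isSub for numden].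
HB.instance Definition _ := [Choice of fraction by <:].

Definition num (x : fraction) : R := (numden x).1.
Definition den (x : fraction) : R := (numden x).2.

Lemma den_lreg x : GRing.lreg (den x).
Proof. by apply/asboolP; case: x. Qed.

Definition mkfrac (a s : R) (sP : GRing.lreg s) : fraction :=
  @Fraction (a, s) (asboolT sP).

Definition equivf (x y : fraction) : bool := num x * den y == num y * den x.

Lemma equivf_refl : reflexive equivf.
Proof. by move=> x; rewrite /equivf. Qed.

Lemma equivf_sym : symmetric equivf.
Proof. by move=> x y; rewrite /equivf eq_sym. Qed.

Lemma equivf_trans : transitive equivf.
Proof.
move=> y x z /eqP xy /eqP yz; apply/eqP; apply: (@den_lreg y).
have -> : den y * (num x * den z) = (num x * den y) * den z by ring.
by rewrite xy mulrAC yz; ring.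
Qed.

Canonical equivf_equiv := EquivRel equivf equivf_refl equivf_sym equivf_trans.

Definition type := {eq_quot equivf}.
#[export]
HB.instance Definition _ : EqQuotient _ equivf type :=
  EqQuotient.on type.
#[export]
HB.instance Definition _ := Choice.on type.

Lemma eq_frac (x y : fraction) :
  num x * den y = num y * den x -> \pi_type x = \pi_type y.
Proof. by move=> xy; apply/eqmodP; rewrite /= /equivf xy. Qed.

Lemma repr_frac (x : fraction) :
  num (repr (\pi_type x)) * den x = num x * den (repr (\pi_type x)).
Proof. by apply/eqP; have /eqP := reprK (\pi_type x); rewrite eqmodE. Qed.

Definition zerof : fraction := mkfrac 0 (@GRing.lreg1 R).
Definition onef : fraction := mkfrac 1 (@GRing.lreg1 R).
Definition addf (x y : fraction) : fraction :=
  mkfrac (num x * den y + num y * den x)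
         (GRing.lregM (@den_lreg x) (@den_lreg y)).
Definition oppf (x : fraction) : fraction := mkfrac (- num x) (@den_lreg x).
Definition mulf (x y : fraction) : fraction :=
  mkfrac (num x * num y) (GRing.lregM (@den_lreg x) (@den_lreg y)).

Lemma num_add x y : num (addf x y) = num x * den y + num y * den x.
Proof. by []. Qed.
Lemma den_add x y : den (addf x y) = den x * den y. Proof. by []. Qed.
Lemma num_opp x : num (oppf x) = - num x. Proof. by []. Qed.
Lemma den_opp x : den (oppf x) = den x. Proof. by []. Qed.
Lemma num_mul x y : num (mulf x y) = num x * num y. Proof. by []. Qed.
Lemma den_mul x y : den (mulf x y) = den x * den y. Proof. by []. Qed.
Lemma num_zero : num zerof = 0. Proof. by []. Qed.
Lemma den_zero : den zerof = 1. Proof. by []. Qed.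
Lemma num_one : num onef = 1. Proof. by []. Qed.
Lemma den_one : den onef = 1. Proof. by []. Qed.
Definition fracE := (num_add, den_add, num_opp, den_opp, num_mul, den_mul,
  num_zero, den_zero, num_one, den_one).

Definition zero : type := lift_cst type zerof.
Definition one : type := lift_cst type onef.
Definition add := lift_op2 type addf.
Definition opp := lift_op1 type oppf.
Definition mul := lift_op2 type mulf.

Canonical pi_zero_morph := PiConst zero.
Canonical pi_one_morph := PiConst one.

Lemma pi_add : {morph \pi : x y / addf x y >-> add x y}.
Proof.
move=> x y; unlock add; apply/esym/eq_frac; rewrite !fracE !mulrDl; congr (_ + _).
  by rewrite mulrACA repr_frac; ring.
by rewrite [den x * _]mulrC mulrACA repr_frac; ring.
Qed.
Canonical pi_add_morph := PiMorph2 pi_add.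

Lemma pi_opp : {morph \pi : x / oppf x >-> opp x}.
Proof.
move=> x; unlock opp; apply/esym/eq_frac.
by rewrite !fracE !mulNr repr_frac.
Qed.
Canonical pi_opp_morph := PiMorph1 pi_opp.

Lemma pi_mul : {morph \pi : x y / mulf x y >-> mul x y}.
Proof.
move=> x y; unlock mul; apply/esym/eq_frac.
by rewrite !fracE mulrACA !repr_frac mulrACA.
Qed.
Canonical pi_mul_morph := PiMorph2 pi_mul.

Fact addA : associative add.
Proof.
move=> x y z; rewrite -[x]reprK -[y]reprK -[z]reprK !piE.
by apply: eq_frac; rewrite !fracE; ring.
Qed.

Fact addC : commutative add.
Proof.
move=> x y; rewrite -[x]reprK -[y]reprK !piE.
by apply: eq_frac; rewrite !fracE; ring.
Qed.

Fact add0 : left_id zero add.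
Proof.
move=> x; rewrite -[x]reprK !piE.
by apply: eq_frac; rewrite !fracE; ring.
Qed.

Fact addN : left_inverse zero opp add.
Proof.
move=> x; rewrite -[x]reprK !piE.
by apply: eq_frac; rewrite !fracE; ring.
Qed.

#[export]
HB.instance Definition _ :=
  GRing.isZmodule.Build type addA addC add0 addN.

Fact mulA : associative mul.
Proof.
move=> x y z; rewrite -[x]reprK -[y]reprK -[z]reprK !piE.
by apply: eq_frac; rewrite !fracE; ring.
Qed.

Fact mulC : commutative mul.
Proof.
move=> x y; rewrite -[x]reprK -[y]reprK !piE.
by apply: eq_frac; rewrite !fracE; ring.
Qed.

Fact mul1 : left_id one mul.
Proof.
move=> x; rewrite -[x]reprK !piE.
by apply: eq_frac; rewrite !fracE; ring.
Qed.

Fact mulDl : left_distributive mul add.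
Proof.
move=> x y z; rewrite -[x]reprK -[y]reprK -[z]reprK !piE.
by apply: eq_frac; rewrite !fracE; ring.
Qed.

Fact one_neq0 : one != zero.
Proof.
rewrite piE /equivf /num /den /= mul0r mul1r.
by rewrite oner_eq0.
Qed.

#[export]
HB.instance Definition _ :=
  GRing.Zmodule_isComNzRing.Build type mulA mulC mul1 mulDl one_neq0.
End TotalQuotient.
End TotalQuotient.
HB.export TotalQuotient.

Notation total_quotient R := (TotalQuotient.type R).

(* Main.v *)
Require Import Defs.
From HB Require Import structures.
From mathcomp Require Import all_boot all_order all_algebra.
From mathcomp Require Import boolp classical_sets functions.
From mathcomp Require Import freeg.

Set Implicit Arguments.
Unset Strict Implicit.
Unset Printing Implicit Defensive.

Import GRing.Theory Num.Theory Order.TTheory.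
Local Open Scope ring_scope.

(* The three dimensions are all 0 if R is reduced and all infinite otherwise.

   R reduced: every ideal I of R, of R[x] and of T = T(R[x]) is such that
   I + Ann(I) contains a finitely generated dense ideal. By Baer's criterion
   every strongly Lucas module is then injective, so every module is
   tau_q-projective; over T, whose finitely generated dense ideals are
   improper, every module is projective.

   R not reduced: let a <> 0 = a^2. As R is tau_q-Noetherian and T is flat over
   R, there are matrices over R whose images D_j over T form an exact complex
   ... -> T^{k_1} -> T^{k_0} with D_0 = [a]. Let A be R, R[x] or T. T-modules
   are strongly Lucas over A and injective T-modules are injective over A, so
   if A/aA has a finite resolution of length n, dimension shifting along
   injective T-modules gives H^{n+1}(Hom(T^k, N)) = 0 for all T-modules N. With
   N the row space of D_n this makes D_n von Neumann regular. Since finitely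
   generated dense ideals of T are improper, regularity of D_{j+1} implies that
   of D_j (Bass), so a = a u a = 0 in T, a contradiction. *)

(** * Linear graphs and Baer's criterion *)

Section LinearGraphs.
Variable R : comNzRingType.
Implicit Types U V W N : lmodType R.

Lemma linear_of_fun U V (f : U -> V) :
  (forall a x y, f (a *: x + y) = a *: f x + f y) ->
  exists g : {linear U -> V}, g =1 f.
Proof.
move=> flin.
pose m := GRing.isLinear.Build R U V *:%R f flin.
pose g : {linear U -> V} := HB.pack f m.
by exists g.
Qed.

Lemma submod_of_pred V (S : V -> Prop) :
  S 0 -> (forall a x y, S x -> S y -> S (a *: x + y)) ->
  exists A : submodClosed V, forall x, x \in A <-> S x.
Proof.
move=> S0 SL; pose p : {pred V} := [pred x | `[< S x >]].
have pP : GRing.subsemimod_closed p.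
  split; [split|].
  - exact/asboolP.
  - move=> x y /asboolP Sx /asboolP Sy; apply/asboolP.
    by rewrite -[x]scale1r; apply: SL.
  - move=> a x /asboolP Sx; apply/asboolP.
    by rewrite -[_ *: _]addr0; apply: SL.
pose m := GRing.isSubmodClosed.Build R V p pP.
pose A : submodClosed V := HB.pack p m.
by exists A => x; split=> /asboolP.
Qed.

Lemma submodule_exists V (S : V -> Prop) :
  S 0 -> (forall a x y, S x -> S y -> S (a *: x + y)) ->
  exists (K : lmodType R) (i : {linear K -> V}),
    injective i /\ forall v, S v <-> exists k, i k = v.
Proof.
move=> S0 SL; have [A AP] := submod_of_pred S0 SL.
have [i iE] := @linear_of_fun (submod_carrier A) V val (fun a x y => linearP _ a x y).
exists (submod_carrier A), i; split=> [x y|v]; first by rewrite !iE => /val_inj.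
split=> [/AP vA|[k <-]]; last by rewrite iE; apply/AP; case: k.
by exists (SubmodCarrier vA); rewrite iE.
Qed.

Lemma quotient_exists V (S : V -> Prop) :
  S 0 -> (forall a x y, S x -> S y -> S (a *: x + y)) ->
  exists (C : lmodType R) (p : {linear V -> C}),
    (forall c, exists v, p v = c) /\ forall v, p v = 0 <-> S v.
Proof.
move=> S0 SL; have [A AP] := submod_of_pred S0 SL.
have piL a x y : \pi_(quot_module A)%qT (a *: x + y)
    = a *: \pi_(quot_module A)%qT x + \pi_(quot_module A)%qT y.
  by rewrite pi_quot_add pi_quot_scale.
have [p pE] := linear_of_fun piL.
exists (quot_module A), p; split=> [c|v].
  by exists (repr c); rewrite pE reprK.
rewrite pE; have -> : (0 : quot_module A) = \pi_(quot_module A)%qT 0.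
  by rewrite -[RHS]pE linear0.
by rewrite -AP -{2}[v]subr0 -quot_eqE; split=> /eqP.
Qed.

(* The graph of a linear map defined on a submodule of [U]. *)
Definition linear_graph U V (G : U -> V -> Prop) :=
  [/\ G 0 0, forall a x y x' y', G x y -> G x' y' -> G (a *: x + x') (a *: y + y')
    & forall y, G 0 y -> y = 0].

Lemma linear_graphZ U V (G : U -> V -> Prop) a x y :
  linear_graph G -> G x y -> G (a *: x) (a *: y).
Proof.
by case=> G0 GL _ Gxy; have := GL a _ _ _ _ Gxy G0; rewrite !addr0.
Qed.

Lemma linear_graphD U V (G : U -> V -> Prop) x y x' y' :
  linear_graph G -> G x y -> G x' y' -> G (x + x') (y + y').
Proof.
by case=> G0 GL _ Gxy Gxy'; have := GL 1 _ _ _ _ Gxy Gxy'; rewrite !scale1r.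
Qed.

Lemma linear_graph_fun U V (G : U -> V -> Prop) x y y' :
  linear_graph G -> G x y -> G x y' -> y = y'.
Proof.
case=> _ GL G00 Gy Gy'; have := GL (-1) _ _ _ _ Gy Gy'.
by rewrite !scaleN1r addNr => /G00 /eqP; rewrite addrC subr_eq0 => /eqP.
Qed.

Lemma linear_of_graph U V (G : U -> V -> Prop) :
  linear_graph G -> (forall x, exists y, G x y) ->
  exists g : {linear U -> V}, forall x, G x (g x).
Proof.
move=> GG /choice[f fG]; have [a x y|g gE] := @linear_of_fun U V f.
  apply: (linear_graph_fun GG (fG _)); case: GG => _ GL _; exact: GL.
by exists g => x; rewrite gE.
Qed.

Lemma linear_corestrict U V (K : lmodType R) (i : {linear K -> V}) (f : {linear U -> V}) :
  injective i -> (forall u, exists k, i k = f u) ->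
  exists g : {linear U -> K}, forall u, i (g u) = f u.
Proof.
move=> i_inj fi; have [||g gP] := @linear_of_graph U K (fun u k => i k = f u).
- split; first by rewrite !linear0.
    by move=> a x y x' y' e e'; rewrite !linearP e e'.
  by move=> y; rewrite linear0 => e; apply: i_inj; rewrite e linear0.
- exact: fi.
by exists g.
Qed.

(** Partial maps are given as graphs, so that Zorn's lemma applies to sets of pairs. *)
Definition injective_module N := forall V (G : V -> N -> Prop),
  linear_graph G -> exists g : {linear V -> N}, forall x y, G x y -> g x = y.

Lemma injective_extend N U V (d : {linear U -> V}) (f : {linear U -> N}) :
  injective_module N -> (forall u, d u = 0 -> f u = 0) ->
  exists g : {linear V -> N}, forall u, g (d u) = f u.
Proof.
move=> Ninj df; have [|g gP] := Ninj V (fun v n => exists u, d u = v /\ f u = n).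
  split; first by exists 0; rewrite !linear0.
    by move=> a _ _ _ _ [u [<- <-]] [u' [<- <-]]; exists (a *: u + u'); rewrite !linearP.
  by move=> _ [u [/df fu0 <-]].
by exists g => u; apply: gP; exists u.
Qed.

(** In a maximal extension of [G], the scalars carrying a given [v] into the domain form an ideal,
    on which the extension is multiplication by some [n]. Sending [v] to [n] extends it further, so
    by maximality [v] was already in the domain. *)
Lemma baer_criterion N :
  (forall G : R^o -> N -> Prop, linear_graph G ->
     exists n, forall a y, G a y -> y = a *: n) ->
  injective_module N.
Proof.
move=> HN V G GG.
(* [X] holds the pairs added to [G], so that the empty chain is bounded by [G] itself. *)
pose gr (X : set (V * N)) x y := G x y \/ X (x, y).
have [F FP Ftot|X [GX Xmax]] := @Zorn_bigcup (V * N)%type (fun X => linear_graph (gr X)).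
  have [[X FX]|F0] := pselect (exists X, F X); last first.
    have -> // : gr (\bigcup_(X in F) X)%classic = G.
    apply/funext => x; apply/funext => y; apply/propext; split=> [[]|]; last by left.
      by [].
    by case=> X FX; case: F0; exists X.
  have sub Y : F Y -> forall x y, gr Y x y -> gr (\bigcup_(X in F) X)%classic x y.
    by move=> FY x y [|Yxy]; [left|right; exists Y].
  have one x y : gr (\bigcup_(X in F) X)%classic x y -> exists2 Y, F Y & gr Y x y.
    case=> [Gxy|[Y FY Yxy]]; first by exists X => //; left.
    by exists Y => //; right.
  split.
  - by left; case: GG.
  - move=> a x y x' y' /one[Y FY Yxy] /one[Y' FY' Yxy'].
    case: (Ftot _ _ FY FY') => YY'.
      apply: (sub Y') => //; have [_ L _] := FP _ FY'; apply: L => //.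
      by case: Yxy => [|/YY']; [left|right].
    apply: (sub Y) => //; have [_ L _] := FP _ FY; apply: L => //.
    by case: Yxy' => [|/YY']; [left|right].
  - by move=> y /one[Y FY]; have [_ _] := FP _ FY; apply.
suff tot v : exists y, gr X v y.
  have [g gP] := linear_of_graph GX tot; exists g => x y Gxy.
  by apply: (linear_graph_fun GX (gP x)); left.
have [|n nP] := HN (fun a y => gr X (a *: v) y).
  have [G0 GL G00] := GX; split; first by rewrite scale0r.
    by move=> a x y x' y' Gx Gx'; rewrite scalerDl -scalerA; apply: GL.
  by move=> y; rewrite scale0r; apply: G00.
pose X' : set (V * N) := fun z => exists x y a,
  [/\ gr X x y, z.1 = x + a *: v & z.2 = y + a *: n].
have grX' x y : gr X' x y -> X' (x, y).
  case=> // Gxy; exists x, y, 0; rewrite /= !scale0r !addr0; split=> //; by left.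
have XX' : (X `<=` X')%classic.
  move=> [x y] Xxy; exists x, y, 0; rewrite /= !scale0r !addr0; split=> //; by right.
have GX' : linear_graph (gr X').
  have [G0 GL G00] := GX; split.
  - by left; case: GG.
  - move=> a x y x' y' /grX'[x1 [y1 [b [/= G1 -> ->]]]] /grX'[x2 [y2 [c [/= G2 -> ->]]]].
    right; exists (a *: x1 + x2), (a *: y1 + y2), (a * b + c); split=> /=.
    + exact: GL.
    + by rewrite scalerDr scalerDl !scalerA addrACA.
    + by rewrite scalerDr scalerDl !scalerA addrACA.
  - move=> y /grX'[x1 [y1 [b [/= G1 /eqP]]]]; rewrite eq_sym addr_eq0 => /eqP x1E ->.
    (* Single-valuedness: from [x1 + b *: v = 0], the value at [b *: v] is [- y1], and the choice of
       [n] makes it [b *: n]. *)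
    have /nP : gr X (b *: v) (- y1).
      rewrite -[b *: v]opprK -x1E -[- x1]scaleN1r -[- y1]scaleN1r.
      exact: linear_graphZ.
    by move=> <-; rewrite subrr.
have /contrapT X'X : ~ ~ (X' `<=` X)%classic.
  by move=> nX'X; apply: (Xmax X') => //; split.
exists n; right; apply: X'X; exists 0, 0, 1; rewrite /= !add0r !scale1r; split=> //.
by case: GX.
Qed.
End LinearGraphs.

Lemma pi_quot0 (A : comNzRingType) (V : lmodType A) (S : submodClosed V) :
  \pi_(quot_module S)%qT 0 = 0.
Proof. by rewrite [RHS]/GRing.zero /= piE. Qed.

(** * Vanishing of Ext^1 and free resolutions *)

Section Extensions.
Variable R : comNzRingType.
Implicit Types K V M N P : lmodType R.

(* [Ext^1(M, N) = 0], read off the long exact sequences of all presentations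
   [K -> V -> M -> 0]. *)
Definition Ext1_vanishes M N := forall K V (d : {linear K -> V}) (p : {linear V -> M}),
  (forall m, exists v, p v = m) -> (forall v, p v = 0 <-> exists k, d k = v) ->
  forall f : {linear K -> N}, (forall k, d k = 0 -> f k = 0) ->
  exists g : {linear V -> N}, forall k, g (d k) = f k.

Lemma injective_Ext1 M N : injective_module N -> Ext1_vanishes M N.
Proof. by move=> Ninj K V d p _ _ f; apply: injective_extend. Qed.

(** A section [s] of [p] gives the projection [v - s (p v)] of [V] onto the image of [d], where [f]
    is well defined. *)
Lemma projective_Ext1 P N : projective P -> Ext1_vanishes P N.
Proof.
move=> Pproj K V d p p_surj dp f df.
have [s sP] := Pproj V P p idfun p_surj.
have [||g gP] := @linear_of_graph R V N
    (fun v n => exists k, d k = v - s (p v) /\ f k = n).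
- split.
  + by exists 0; rewrite !linear0 addr0.
  + move=> a x y x' y' [k [dk <-]] [k' [dk' <-]]; exists (a *: k + k').
    split; last by rewrite linearP.
    by rewrite linearP dk dk' [p (_ + _)]linearP [s (_ + _)]linearP scalerBr addrACA -opprD.
  + by move=> _ [k [dk <-]]; apply: df; rewrite dk !linear0 addr0.
- move=> v; have [k dk] : exists k, d k = v - s (p v).
    by apply/dp; rewrite linearB /= sP subrr.
  by exists (f k), k.
exists g => k; have [k' [dk' <-]] := gP (d k).
have pdk : p (d k) = 0 by apply/dp; exists k.
apply/eqP; rewrite -subr_eq0 -linearB; apply/eqP/df.
by rewrite linearB /= dk' pdk linear0 subr0 subrr.
Qed.

Lemma trivial_Ext1 M N : (forall m : M, m = 0) -> Ext1_vanishes M N.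
Proof.
move=> M0; apply: projective_Ext1 => A B g f _.
have [|h hE] := @linear_of_fun R M A (fun=> 0).
  by move=> *; rewrite scaler0 addr0.
by exists h => x; rewrite hE (M0 x) !linear0.
Qed.

(** The pullback [X] of [V] and [P 0] over [M] is an extension of [P 0] by the image of [d], so [f]
    extends to [h] on [X]. Pulled back to [P 1], [h] is a cocycle; subtracting its primitive [g]
    makes [h] vanish on the kernel of [X -> V] and descend to [V]. *)
Lemma Ext1_of_resolution M N (P : resolution M) :
  Ext1_vanishes (P 0%N) N ->
  (forall f : {linear P 1%N -> N}, cocycle f -> coboundary f) ->
  Ext1_vanishes M N.
Proof.
move=> ExtP0 H1 K V d p p_surj dp f df.
have [||X [i [i_inj iP]]] := @submodule_exists R (V * P 0%N)%type
    (fun z => p z.1 = res_aug P z.2).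
- by rewrite !linear0.
- by move=> a x y /= e e'; rewrite !linearP e e'.
have [j jP] : exists j : {linear K -> X}, forall k, i (j k) = (d k, 0).
  have [|dk dkE] := @linear_of_fun R K (V * P 0%N)%type (fun k => (d k, 0)).
    by move=> a x y; rewrite !linearP; congr pair; rewrite /= scaler0 addr0.
  have [|j jP] := linear_corestrict (f := dk) i_inj.
    by move=> k; apply/iP; rewrite dkE /= linear0; apply/dp; exists k.
  by exists j => k; rewrite jP dkE.
have [q qP] : exists q : {linear P 1%N -> X}, forall y, i (q y) = (0, res_diff P 0%N y).
  have [|dk dkE] := @linear_of_fun R (P 1%N) (V * P 0%N)%type (fun y => (0, res_diff P 0%N y)).
    by move=> a x y; rewrite !linearP; congr pair; rewrite /= scaler0 addr0.
  have [|q qP] := linear_corestrict (f := dk) i_inj.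
    move=> y; apply/iP; rewrite dkE /= linear0; apply/esym/res_exact0.
    by exists y.
  by exists q => y; rewrite qP dkE.
have [p2 p2E] : exists p2 : {linear X -> P 0%N}, forall x, p2 x = (i x).2.
  by apply: linear_of_fun => a x y; rewrite linearP.
have [|||h hP] := ExtP0 K X j p2 _ _ f.
- move=> y; have [v vy] := p_surj (res_aug P y).
  have [x xE] : exists x, i x = (v, y) by apply/iP.
  by exists x; rewrite p2E xE.
- move=> x; rewrite p2E; split=> [x2|[k <-]]; last by rewrite jP.
  have x1 : p (i x).1 = 0.
    have /iP -> : exists k, i k = i x by exists x.
    by rewrite x2 linear0.
  have /dp[k kx] := x1; exists k; apply: i_inj; rewrite jP kx.
  by rewrite [RHS]surjective_pairing x2.
- by move=> k jk; apply: df; have := jP k; rewrite jk linear0; case.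
have [f1 f1E] : exists f1 : {linear P 1%N -> N}, forall y, f1 y = h (q y).
  by apply: linear_of_fun => a x y; rewrite !linearP.
have [|g gP] := H1 f1.
  move=> y; rewrite f1E; have -> : q (res_diff P 1%N y) = 0.
    apply: i_inj; rewrite qP linear0; congr pair.
    by apply/res_exact; exists y.
  by rewrite linear0.
have [||G GP] := @linear_of_graph R V N
    (fun v n => exists x, (i x).1 = v /\ h x - g (i x).2 = n).
- split.
  + by exists 0; rewrite !linear0 addr0.
  + move=> a _ _ _ _ [x [<- <-]] [x' [<- <-]]; exists (a *: x + x').
    rewrite linearP; split=> //; rewrite linearP [(_ + _).2]/= linearP.
    by rewrite scalerBr addrACA -opprD.
  + move=> _ [x [x1 <-]].
    have : res_aug P (i x).2 = 0.
      have /iP <- : exists k, i k = i x by exists x.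
      by rewrite x1 linear0.
    move=> /res_exact0[y yx]; have -> : x = q y.
      by apply: i_inj; rewrite qP yx -x1 -surjective_pairing.
    by rewrite qP /= -f1E gP subrr.
- move=> v; have [y yv] := res_aug_surj P (p v).
  have [x xE] : exists x, i x = (v, y) by apply/iP.
  by exists (h x - g (i x).2), x; rewrite xE.
exists G => k; have [x [xk <-]] := GP (d k).
have : res_aug P (i x).2 = 0.
  have /iP <- : exists k', i k' = i x by exists x.
  by rewrite xk; apply/dp; exists k.
move=> /res_exact0[y yx]; have -> : x = j k + q y.
  apply: i_inj; rewrite linearD /= jP qP yx.
  by rewrite [LHS]surjective_pairing xk; congr pair; rewrite /= ?addr0 ?add0r.
by rewrite linearD hP linearD /= jP qP /= add0r -f1E gP addrK.
Qed.

(** The pullback [X] of [g] along [f] is an extension of [P] by [N], and Ext^1 vanishing retracts it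
    onto [N] by [r]. Subtracting [i \o r] from the second coordinate gives a map that descends to
    [P]. *)
Lemma Ext1_lift P N (E C : lmodType R) (i : {linear N -> E}) (g : {linear E -> C}) :
  Ext1_vanishes P N -> injective i -> (forall c, exists e, g e = c) ->
  (forall e, g e = 0 <-> exists n, i n = e) ->
  forall f : {linear P -> C}, exists h : {linear P -> E}, forall x, g (h x) = f x.
Proof.
move=> ExtP i_inj g_surj gi f.
have [||X [j [j_inj jP]]] := @submodule_exists R (P * E)%type
    (fun z => f z.1 = g z.2).
- by rewrite !linear0.
- by move=> a x y /= e e'; rewrite !linearP e e'.
have [k kP] : exists k : {linear N -> X}, forall n, j (k n) = (0, i n).
  have [|l lE] := @linear_of_fun R N (P * E)%type (fun n => (0, i n)).
    by move=> a x y; rewrite !linearP; congr pair; rewrite /= scaler0 addr0.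
  have [|k kP] := linear_corestrict (f := l) j_inj.
    by move=> n; apply/jP; rewrite lE /= linear0; apply/esym/gi; exists n.
  by exists k => n; rewrite kP lE.
have [p1 p1E] : exists p1 : {linear X -> P}, forall x, p1 x = (j x).1.
  by apply: linear_of_fun => a x y; rewrite linearP.
have [|||r rP] := ExtP N X k p1 _ _ idfun.
- move=> y; have [e ey] := g_surj (f y).
  have [x xE] : exists x, j x = (y, e) by apply/jP.
  by exists x; rewrite p1E xE.
- move=> x; rewrite p1E; split=> [x1|[n <-]]; last by rewrite kP.
  have : g (j x).2 = 0.
    have /jP <- : exists k, j k = j x by exists x.
    by rewrite x1 linear0.
  move=> /gi[n nx]; exists n; apply: j_inj; rewrite kP nx -x1.
  by rewrite -surjective_pairing.
- move=> n kn /=; apply: i_inj; have := kP n.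
  by rewrite kn !linear0; case.
have [||h hP] := @linear_of_graph R P E
    (fun y e => exists x, (j x).1 = y /\ (j x).2 - i (r x) = e).
- split.
  + by exists 0; rewrite !linear0 addr0.
  + move=> a _ _ _ _ [x [<- <-]] [x' [<- <-]]; exists (a *: x + x').
    rewrite linearP; split=> //; rewrite [r _]linearP [i (_ + _)]linearP /=.
    by rewrite scalerBr addrACA -opprD.
  + move=> _ [x [x1 <-]].
    have : g (j x).2 = 0.
      have /jP <- : exists k, j k = j x by exists x.
      by rewrite x1 linear0.
    move=> /gi[n nx]; have -> : x = k n.
      by apply: j_inj; rewrite kP nx -x1 -surjective_pairing.
    by rewrite kP rP /= subrr.
- move=> y; have [e ey] := g_surj (f y).
  have [x xE] : exists x, j x = (y, e) by apply/jP.
  by exists ((j x).2 - i (r x)), x; rewrite xE.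
exists h => y; have [x [<- <-]] := hP y; rewrite linearB /=.
have -> : g (i (r x)) = 0 by apply/gi; exists (r x).
by rewrite subr0; apply/esym/jP; exists x.
Qed.
End Extensions.

Section FreeResolutions.
Variable R : comNzRingType.

Lemma fglift_linear (K : choiceType) (V : lmodType R) (x : K -> V) :
  exists h : {linear {freeg K / R} -> V}, forall k, h << k >> = x k.
Proof.
pose m := GRing.isZmodMorphism.Build _ _ (fglift x) (lift_is_additive x).
pose L : {additive {freeg K / R} -> V} := HB.pack (fglift x) m.
have LE k a : L << a *g k >> = a *: x k by exact: liftU.
have [a D D'|h hE] := @linear_of_fun R {freeg K / R} V L.
  rewrite raddfD; congr (_ + _).
  transitivity (\sum_(k <- dom D) (a * coeff k D) *: x k).
    by rewrite -[a *: D]/(fgscale a D) /fgscale raddf_sum; apply: eq_bigr => k _.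
  rewrite -[X in L X](freeg_sumE D) raddf_sum scaler_sumr.
  by apply: eq_bigr => k _; rewrite LE scalerA.
by exists h => k; rewrite hE LE scale1r.
Qed.

Lemma freeg_projective (K : choiceType) : projective ({freeg K / R} : lmodType R).
Proof.
move=> A B g f g_surj.
have /choice[x xP] : forall k : K, exists a, g a = f << k >> by move=> k.
have [h hP] := fglift_linear x; exists h => D.
have unitE c k : << c *g k >> = c *: << k >> :> {freeg K / R}.
  by apply/eqP/freeg_eqP => y; rewrite coeffZ !coeffU mul1r.
have unitZ (V : lmodType R) (l : {linear {freeg K / R} -> V}) c k :
    l << c *g k >> = c *: l << k >>.
  by rewrite unitE; exact: (linearZ_LR l c << k >>).
rewrite -(freeg_sumE D) !raddf_sum; apply: eq_bigr => k _.
transitivity (coeff k D *: f << k >>); last exact/esym/unitZ.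
by rewrite -xP -hP -linearZ_LR; congr (g _); exact: unitZ.
Qed.

Lemma enough_projectives (M : lmodType R) :
  exists (P : lmodType R) (p : {linear P -> M}),
    projective P /\ forall m, exists x, p x = m.
Proof.
have [p pP] := fglift_linear (@id M).
exists {freeg M / R}, p; split=> [|m]; first exact: freeg_projective.
by exists << m >>.
Qed.

(** One sigma type holds all the data, so that a choice of it can be iterated into a resolution. *)
Lemma syzygy_exists (M : lmodType R) :
  exists s : {P : lmodType R & {p : {linear P -> M} &
      {K : lmodType R & {linear K -> P}}}},
    let: existT P (existT p (existT K i)) := s in
    [/\ projective P, forall m, exists x, p x = m, injective i
      & forall x, p x = 0 <-> exists k, i k = x].
Proof.
have [P [p [Pproj p_surj]]] := enough_projectives M.
have [||K [i [i_inj iP]]] := @submodule_exists R P (fun x => p x = 0).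
- by rewrite linear0.
- by move=> a x y px py; rewrite linearP px py scaler0 addr0.
by exists (existT _ P (existT _ p (existT _ K i))).
Qed.

Lemma projective_resolution_exists (M : lmodType R) :
  exists P : resolution M, forall i, projective (P i).
Proof.
pose s (V : lmodType R) := sval (cid (syzygy_exists V)).
pose P V := projT1 (s V).
pose p V : {linear P V -> V} := projT1 (projT2 (s V)).
pose K V := projT1 (projT2 (projT2 (s V))).
pose i V : {linear K V -> P V} := projT2 (projT2 (projT2 (s V))).
have sP V : [/\ projective (P V), forall m, exists x, p V x = m, injective (i V)
      & forall x, p V x = 0 <-> exists k, i V k = x].
  rewrite /P /p /K /i /s; case: cid => /= -[P' [p' [K' i']]] /=.
  by [].
pose S n := iter n K M.
pose d n : {linear P (S n.+1) -> P (S n)} := i (S n) \o p (S n.+1).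
have dE n x : d n x = i (S n) (p (S n.+1) x) by [].
have [P0 P0E] : exists P0 : resolution M, (P0 : nat -> lmodType R) = P \o S.
  have e0 x : p M x = 0 <-> exists y, d 0%N y = x.
    have [_ _ _ ip] := sP M; have [_ p_surj _ _] := sP (S 1%N).
    rewrite ip; split=> [[k <-]|[y <-]]; last by exists (p (S 1%N) y).
    by have [y yk] := p_surj k; exists y; rewrite dE yk.
  have e n x : d n x = 0 <-> exists y, d n.+1 y = x.
    have [_ _ i_inj _] := sP (S n); have [_ _ _ ip] := sP (S n.+1).
    have [_ p_surj _ _] := sP (S n.+2).
    have -> : d n x = 0 <-> p (S n.+1) x = 0.
      rewrite dE; split=> [e|->]; last by rewrite linear0.
      by apply: i_inj; rewrite e linear0.
    rewrite ip; split=> [[k <-]|[y <-]]; last by exists (p (S n.+2) y).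
    by have [y yk] := p_surj k; exists y; rewrite dE yk.
  have [_ p_surj _ _] := sP M.
  by exists (@Resolution R M (P \o S) d (p M) p_surj e0 e).
by exists P0 => n; rewrite P0E /=; have [] := sP (S n).
Qed.

(** [Ext_zero] quantifies over projective resolutions, so the direct implication rests on the
    existence of one; conversely [P 1 -> P 0 -> M] is a presentation. *)
Lemma Ext1_vanishesP (M N : lmodType R) : Ext_zero 1 M N <-> Ext1_vanishes M N.
Proof.
split=> [ExtMN|ExtMN P _ f f0].
  have [P Pproj] := projective_resolution_exists M.
  apply: (@Ext1_of_resolution R M N P); first exact: projective_Ext1.
  exact: ExtMN.
have [|||g gP] := ExtMN _ _ (res_diff P 0%N) (res_aug P) _ _ f.
- exact: res_aug_surj.
- exact: res_exact0.
- by move=> x /res_exact[y <-]; apply: f0.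
by exists g => x; rewrite gP.
Qed.
End FreeResolutions.

(** * Enough injectives *)

(** Baer's criterion: a nonzero ideal is generated by its least positive element [m], and the image
    of 1 is the value at [m] divided by [m]. *)
Lemma int_divisible_injective (D : lmodType int) :
  (forall (m : nat) (d : D), (0 < m)%N -> exists e, m%:Z *: e = d) ->
  injective_module D.
Proof.
move=> Ddiv; apply: baer_criterion => G GG.
have [ex|nex] := pselect (exists m : nat, `[< (0 < m)%N /\ exists y, G m%:Z y >]); last first.
  exists 0 => a y Gay; rewrite scaler0; have [_ _ G00] := GG.
  have [a0|a0] := eqVneq a 0; first by apply: G00; rewrite -a0.
  case: nex; exists `|a|%N; apply/asboolP; split; first by rewrite absz_gt0.
  exists (Num.sg a *: y); rewrite abszE normrEsg.
  exact: (linear_graphZ _ GG Gay).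
case: (ex_minnP ex) => m /asboolP[m0 [y0 Gy0]] m_min.
have [e ey0] := Ddiv m y0 m0; exists e => a y Gay.
have am : (a %% m)%Z = 0.
  apply/eqP; rewrite -absz_eq0; apply/negPn; rewrite -lt0n; apply/negP => am0.
  have mn0 : m%:Z != 0 by case: (m) m0.
  have lt_am : (`|(a %% m)%Z| < m)%N by rewrite -ltz_nat gez0_abs ?modz_ge0 // ltz_pmod.
  suff /m_min : `[< (0 < `|(a %% m)%Z|)%N /\ exists y, G `|(a %% m)%Z|%:Z y >].
    by rewrite leqNgt lt_am.
  apply/asboolP; split=> //.
  exists (- (a %/ m)%Z *: y0 + y); rewrite gez0_abs ?modz_ge0 //.
  have -> : (a %% m)%Z = - (a %/ m)%Z * m + a.
    by rewrite {3}(divz_eq a m) mulNr addKr.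
  exact: (linear_graphD GG (linear_graphZ _ GG Gy0) Gay).
have aE : a = (a %/ m)%Z * m by rewrite {1}(divz_eq a m) am addr0.
apply: (linear_graph_fun GG Gay).
rewrite {1 2}aE -scalerA ey0.
exact: linear_graphZ GG Gy0.
Qed.

(** The module is Q/Z. A nonzero [x] is sent to the class of [1/k], with [k > 1] dividing every
    integer that kills [x]; injectivity extends this map. *)
Lemma injective_cogenerator_int : exists D : lmodType int, injective_module D /\
  forall (N : lmodType int) (x : N), x <> 0 -> exists f : {linear N -> D}, f x <> 0.
Proof.
have [||D [p [p_surj p0]]] := @quotient_exists int (zmodule rat)
    (fun x => (x : rat) \is a Num.int).
- exact: rpred0.
- by move=> a x y xZ yZ; rewrite rpredD // scalezrE rpredMz.
exists D; have Dinj : injective_module D.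
  apply: int_divisible_injective => m d m0; have [q <-] := p_surj d.
  exists (p ((q : rat) / m%:R)); rewrite -linearZ; congr (p _).
  by rewrite scalezrE -mulrzl mulrC divfK // pnatr_eq0 -lt0n.
split=> // N x x0.
(* [k] is the order of [x], or 2 if the order is infinite. *)
have [k k1 kP] : exists2 k : nat, (1 < k)%N & forall z : int, z *: x = 0 -> (k %| z)%Z.
  have [ex|nex] := pselect (exists m : nat, `[< (0 < m)%N /\ m%:Z *: x = 0 >]); last first.
    exists 2%N => // z zx; have [-> //|z0] := eqVneq z 0.
    case: nex; exists `|z|%N; apply/asboolP; split; first by rewrite absz_gt0.
    by rewrite abszE normrEsg -scalerA zx scaler0.
  case: (ex_minnP ex) => k /asboolP[k0 kx] k_min; exists k.
    rewrite ltn_neqAle k0 andbT; apply/eqP => k1; apply: x0.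
    by rewrite -[x]scale1r -kx -k1.
  move=> z zx; apply/dvdz_mod0P/eqP; rewrite -absz_eq0; apply/negPn.
  rewrite -lt0n; apply/negP => zk0.
  have kn0 : k%:Z != 0 by case: (k) k0.
  have lt_zk : (`|(z %% k)%Z| < k)%N by rewrite -ltz_nat gez0_abs ?modz_ge0 // ltz_pmod.
  suff /k_min : `[< (0 < `|(z %% k)%Z|)%N /\ `|(z %% k)%Z|%:Z *: x = 0 >].
    by rewrite leqNgt lt_zk.
  apply/asboolP; split=> //.
  rewrite gez0_abs ?modz_ge0 //.
  have -> : (z %% k)%Z = z - (z %/ k)%Z * k by rewrite {2}(divz_eq z k) addrAC subrr add0r.
  by rewrite scalerBl zx -scalerA kx scaler0 subrr.
have [d dE] : exists d : {linear int^o -> N}, forall z, d z = z *: x.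
  by apply: linear_of_fun => a y z; rewrite scalerDl scalerA.
have [f fE] : exists f : {linear int^o -> D}, forall z, f z = z *: p (k%:R^-1 : rat).
  by apply: linear_of_fun => a y z; rewrite scalerDl scalerA.
have kn0 : k%:R != 0 :> rat by rewrite pnatr_eq0 -lt0n ltnW.
have [|g gP] := injective_extend (d := d) (f := f) Dinj.
  move=> z; rewrite dE fE => /kP /dvdzP[q ->]; rewrite -linearZ; apply/p0.
  by rewrite scalezrE -mulrzl intrM -mulrA divff // mulr1 intr_int.
exists g; rewrite -[x]scale1r -dE gP fE scale1r => /p0 /intrP[z zE].
have := congr1 (fun t => t * k%:R) zE; rewrite mulVf // -[k%:R]/(k%:~R) -intrM.
move=> /(@intr_inj rat 1) zk.
by have := congr1 absz (esym zk); rewrite abszM => /eqP; rewrite muln_eq1 (gtn_eqF k1) andbF.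
Qed.

Section Coinduced.
Variables (T : comNzRingType) (D : zmodType).

Definition additive_fun : {pred T -> D} :=
  [pred f : T -> D | `[< forall s t, f (s + t) = f s + f t >]].

Fact additive_fun_zmod : zmod_closed additive_fun.
Proof.
split=> [|f g /asboolP fD /asboolP gD]; apply/asboolP => s t.
  by rewrite /GRing.zero /= addr0.
by rewrite -[LHS]/(f (s + t) - g (s + t)) fD gD opprD addrACA.
Qed.
HB.instance Definition _ := GRing.isZmodClosed.Build _ additive_fun additive_fun_zmod.

(** This is Hom_Z(T, D), a [T]-module through the argument of the maps. *)
Record coinduced := Coinduced { coinduced_val :> T -> D; _ : coinduced_val \in additive_fun }.
HB.instance Definition _ := [isSub for coinduced_val].
HB.instance Definition _ := [Choice of coinduced by <:].
HB.instance Definition _ := [SubChoice_isSubZmodule of coinduced by <:].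

Lemma coinducedD (f : coinduced) s t : f (s + t) = f s + f t.
Proof. by case: f => f /= /asboolP. Qed.

Lemma coinduced_addE (f g : coinduced) s : (f + g) s = f s + g s.
Proof. by []. Qed.

Fact coinduced_scale_subproof a (f : coinduced) :
  (fun s => f (s * a)) \in additive_fun.
Proof. by apply/asboolP => s t; rewrite mulrDl coinducedD. Qed.

Definition coinduced_scale a (f : coinduced) := Coinduced (coinduced_scale_subproof a f).

Fact coinduced_scaleA a b f :
  coinduced_scale a (coinduced_scale b f) = coinduced_scale (a * b) f.
Proof. by apply/val_inj/funext => s; rewrite /= mulrA. Qed.

Fact coinduced_scale1 : left_id 1 coinduced_scale.
Proof. by move=> f; apply/val_inj/funext => s; rewrite /= mulr1. Qed.

Fact coinduced_scaleDr : right_distributive coinduced_scale +%R.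
Proof. by move=> a f g; apply/val_inj/funext. Qed.

Fact coinduced_scaleDl f : {morph coinduced_scale^~ f : a b / a + b}.
Proof. by move=> a b; apply/val_inj/funext => s; rewrite /= mulrDr coinducedD. Qed.

HB.instance Definition _ := GRing.Zmodule_isLmodule.Build T coinduced
  coinduced_scaleA coinduced_scale1 coinduced_scaleDr coinduced_scaleDl.
End Coinduced.

(** By adjunction, [T]-linear maps into Hom_Z(T, D) are additive maps into [D]: evaluate at 1,
    extend to [g] by injectivity of [D], and return with [s] mapped to [g (s *: v)]. The index set
    [I] provides products. *)
Lemma coinduced_injective (T : comNzRingType) (D : lmodType int) (I : Type) :
  injective_module D -> injective_module (I -> coinduced T D).
Proof.
move=> Dinj V G GG.
have evZ (i : I) (e : I -> coinduced T D) (a : int) : (e *~ a) i 1 = a *: (e i 1 : D).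
  pose ev (f : I -> coinduced T D) : D := f i 1.
  have evB : zmod_morphism ev by [].
  pose L : {additive (I -> coinduced T D) -> D} :=
    HB.pack ev (GRing.isZmodMorphism.Build _ _ ev evB).
  by rewrite -[LHS]/(L (e *~ a)) raddfMz /= -scaler_int intz.
have /choice[g gP] (i : I) : exists g : {linear zmodule V -> D},
    forall x e, G x e -> g x = e i 1.
  have [|g gP] := Dinj (zmodule V) (fun x d => exists2 e, G x e & d = e i 1).
    have [G0 GL G00] := GG; split.
    - by exists 0.
    - move=> a x _ x' _ [e Ge ->] [e' Ge' ->]; exists (e *~ a + e').
        by rewrite scalezrE -scaler_int -[e *~ a]scaler_int; apply: GL.
      by rewrite coinduced_addE evZ.
    - by move=> d [e /G00 -> ->].
  by exists g => x e Ge; apply: gP; exists e.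
have hP v i : (fun s : T => g i (s *: v)) \in @additive_fun T D.
  by apply/asboolP => s t; rewrite scalerDl; exact: raddfD.
pose h v : I -> coinduced T D := fun i => Coinduced (hP v i).
have [|H HE] := @linear_of_fun T V _ h.
  move=> a x y; apply/funext => i; apply/val_inj/funext => s /=.
  rewrite scalerDr [LHS]raddfD; congr (_ + _).
  by rewrite scalerA.
exists H => x e Ge; rewrite HE; apply/funext => i; apply/val_inj/funext => s /=.
rewrite (gP i _ _ (linear_graphZ s GG Ge)).
by rewrite -[LHS]/(e i (1 * s)) mul1r.
Qed.

(** [N] embeds into the product of copies of Hom_Z(T, D) indexed by all additive maps [N -> D];
    these separate points as [D] is a cogenerator. *)
Lemma enough_injectives (T : comNzRingType) (N : lmodType T) :
  exists (E : lmodType T) (i : {linear N -> E}), injective_module E /\ injective i.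
Proof.
have [D [Dinj Dcogen]] := injective_cogenerator_int.
pose I := {linear zmodule N -> D}.
have jP n (f : I) : (fun s : T => f (s *: n)) \in @additive_fun T D.
  by apply/asboolP => s t; rewrite scalerDl; exact: raddfD.
pose j n : I -> coinduced T D := fun f => Coinduced (jP n f).
have [|i iE] := @linear_of_fun T N _ j.
  move=> a x y; apply/funext => f; apply/val_inj/funext => s /=.
  rewrite scalerDr [LHS]raddfD; congr (_ + _).
  by rewrite scalerA.
exists (I -> coinduced T D), i; split; first exact: coinduced_injective.
have i0 n : i n = 0 -> n = 0; last first.
  by move=> x y /eqP; rewrite -subr_eq0 -linearB => /eqP/i0/eqP; rewrite subr_eq0 => /eqP.
rewrite iE => jn0; apply: contrapT => n0.
have [f fn] := Dcogen (zmodule N) n n0; apply: fn.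
by rewrite -[n]scale1r -[LHS]/(j n f 1) jn0.
Qed.

(** * Restriction of scalars along a flat morphism *)

Definition restr (A T : comNzRingType) (phi : {rmorphism A -> T}) (N : lmodType T) : Type := N.

Section RestrictionOfScalars.
Variables (A T : comNzRingType) (phi : {rmorphism A -> T}).

HB.instance Definition _ (N : lmodType T) := GRing.Zmodule.on (restr phi N).

Section RestrLmodule.
Variable N : lmodType T.
Definition restr_scale (a : A) (x : restr phi N) : restr phi N := phi a *: (x : N).

Fact restr_scaleA a b x : restr_scale a (restr_scale b x) = restr_scale (a * b) x.
Proof. by rewrite /restr_scale scalerA rmorphM. Qed.
Fact restr_scale1 : left_id 1 restr_scale.
Proof. by move=> x; rewrite /restr_scale rmorph1 scale1r. Qed.
Fact restr_scaleDr : right_distributive restr_scale +%R.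
Proof. by move=> a x y; exact: scalerDr. Qed.
Fact restr_scaleDl x : {morph restr_scale^~ x : a b / a + b}.
Proof. by move=> a b; rewrite /restr_scale rmorphD scalerDl. Qed.

HB.instance Definition _ := GRing.Zmodule_isLmodule.Build A (restr phi N)
  restr_scaleA restr_scale1 restr_scaleDr restr_scaleDl.

Lemma restrZ a (x : restr phi N) : a *: x = phi a *: (x : N) :> N.
Proof. by []. Qed.
End RestrLmodule.

Lemma restr_linear (N N' : lmodType T) (f : {linear N -> N'}) :
  exists g : {linear restr phi N -> restr phi N'}, forall x : N, g x = f x.
Proof.
apply: (@linear_of_fun A (restr phi N) (restr phi N') f) => a x y.
exact: (linearP f (phi a) x y).
Qed.

(* The equational criterion of flatness: relations over [T] between rows with
   entries in [A] are combinations of relations over [A]. *)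
Definition flat_morphism := forall p q (M : 'M[A]_(p, q)) (w : 'rV[T]_p),
  w *m map_mx phi M = 0 ->
  exists m (u : 'rV[T]_m) (L : 'M[A]_(m, p)), L *m M = 0 /\ w = u *m map_mx phi L.

(** A partial map on an ideal of [A] extends to the generated ideal of [T], sending a sum of
    [t * phi a] to the sum of [t *: y]. Flatness makes this well defined, and injectivity over [T]
    concludes. *)
Lemma restr_injective (E : lmodType T) :
  flat_morphism -> injective_module E -> injective_module (restr phi E).
Proof.
move=> flat Einj; apply: baer_criterion => G GG.
pose G' (t : T^o) (e : E) := exists s : seq (T * (A * E)),
  [/\ forall z, z \in s -> G z.2.1 z.2.2, t = \sum_(z <- s) z.1 * phi z.2.1
    & e = \sum_(z <- s) z.1 *: z.2.2].
have [|g gP] := Einj T^o G'; last first.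
  exists (g 1) => a y Gay; rewrite restrZ -linearZ /= [_ *: _]mulr1.
  apply/esym/gP; exists [:: (1, (a, y))]; split=> /=.
  - by move=> z; rewrite inE => /eqP ->.
  - by rewrite big_seq1 mul1r.
  - by rewrite big_seq1 scale1r.
split.
- by exists [::]; split=> //; rewrite big_nil.
- move=> b t e t' e' [s [sG -> ->]] [s' [sG' -> ->]].
  exists ([seq (b * z.1, z.2) | z <- s] ++ s'); split.
  + by move=> z; rewrite mem_cat => /orP[/mapP[z' /sG Gz' ->]|/sG'].
  + rewrite big_cat big_map; congr (_ + _); rewrite [LHS]mulr_sumr.
    by apply: eq_bigr => z _; rewrite mulrA.
  + rewrite big_cat big_map; congr (_ + _); rewrite scaler_sumr.
    by apply: eq_bigr => z _; rewrite scalerA.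
- move=> e [s [sG s0 ->]].
  pose z0 : T * (A * E) := (0, (0, 0)).
  rewrite (big_nth z0) big_mkord in s0; rewrite (big_nth z0) big_mkord.
  pose a (i : 'I_(size s)) := (nth z0 s i).2.1.
  pose y (i : 'I_(size s)) := (nth z0 s i).2.2.
  have Gay i : G (a i) (y i) by exact/sG/mem_nth.
  have [|m [u [L [LM0 uL]]]] := flat _ 1%N (\col_i a i) (\row_i (nth z0 s i).1).
    apply/matrixP => i j; rewrite !mxE [RHS]s0; apply: eq_bigr => l _; by rewrite !mxE.
  (* A row of [L] is a relation over [A] between the [a i], which the graph [G] transfers to the
     [y i]. *)
  have Ly l : \sum_i phi (L l i) *: y i = 0.
    have [_ _ G00] := GG; apply: G00.
    have <- : \sum_i L l i * a i = 0.
      have := congr1 (fun M : 'M_(m, 1) => M l 0) LM0; rewrite !mxE => LM0l.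
      by rewrite -[RHS]LM0l; apply: eq_bigr => i _; rewrite !mxE.
    elim/big_rec2: _ => [|i z x _ Gx]; first by case: GG.
    apply: (linear_graphD GG _ Gx); exact: (linear_graphZ _ GG (Gay i)).
  transitivity (\sum_i \sum_l (u 0 l * phi (L l i)) *: y i).
    apply: eq_bigr => i _; rewrite -scaler_suml; congr (_ *: _).
    have := congr1 (fun M : 'rV_(size s) => M 0 i) uL; rewrite !mxE => ->.
    by apply: eq_bigr => l _; rewrite !mxE.
  rewrite exchange_big big1 // => l _.
  under eq_bigr do rewrite -scalerA.
  by rewrite -scaler_sumr Ly scaler0.
Qed.
End RestrictionOfScalars.

Section Homotopy.
Variables (A : comNzRingType) (M : lmodType A) (P : resolution M).
Hypothesis P_proj : forall i, projective (P i).
Variables (a : A) (aM : forall m : M, a *: m = 0).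

Lemma projective_lift (Q V K : lmodType A) (d : {linear K -> V}) (f : {linear Q -> V}) :
  projective Q -> (forall x, exists k, d k = f x) ->
  exists h : {linear Q -> K}, forall x, d (h x) = f x.
Proof.
move=> Qproj df.
have [||I [i [i_inj iP]]] := @submodule_exists A V (fun v => exists k, d k = v).
- by exists 0; rewrite linear0.
- by move=> b _ _ [k <-] [l <-]; exists (b *: k + l); rewrite linearP.
have [|d' d'E] := linear_corestrict (f := d) i_inj.
  by move=> k; apply/iP; exists k.
have [|f' f'E] := linear_corestrict (f := f) i_inj.
  by move=> x; apply/iP.
have [|h hP] := Qproj _ _ d' f'.
  move=> y; have /iP[k ky] : exists y', i y' = i y by exists y.
  by exists k; apply: i_inj; rewrite d'E.
by exists h => x; rewrite -d'E hP f'E.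
Qed.

Let scaled_map n (f : {linear P n -> P n}) : exists g : {linear P n -> P n},
  forall x, g x = a *: x - f x.
Proof.
apply: linear_of_fun => b x y.
by rewrite linearP scalerDr opprD addrACA scalerBr !scalerA mulrC.
Qed.

(** Multiplication by [a] lifts the zero map of [M], hence is null-homotopic on [P]. The induction
    carries only the identity [d s0 d = a d], which [s1] inherits from the homotopy relation
    evaluated on boundaries. *)
Lemma resolution_homotopy n :
  exists (s0 : {linear P n -> P n.+1}) (s1 : {linear P n.+1 -> P n.+2}),
    forall x, a *: x = res_diff P n.+1 (s1 x) + s0 (res_diff P n x).
Proof.
(* The hypothesis says that [a - s0 d] takes values in cycles, so it lifts through the next
   differential. *)
have step m (s0 : {linear P m -> P m.+1}) :
    (forall x, res_diff P m (s0 (res_diff P m x)) = a *: res_diff P m x) ->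
    exists s1 : {linear P m.+1 -> P m.+2},
      forall x, a *: x = res_diff P m.+1 (s1 x) + s0 (res_diff P m x).
  move=> s0P; have [c cE] : exists c : {linear P m.+1 -> P m.+1},
      forall x, c x = s0 (res_diff P m x).
    by apply: linear_of_fun => b x y; rewrite !linearP.
  have [f fE] := scaled_map c.
  have [x|s1 s1P] := projective_lift (d := res_diff P m.+1) (f := f) (@P_proj m.+1).
    by apply/res_exact; rewrite fE linearB linearZ /= cE s0P subrr.
  by exists s1 => x; rewrite s1P fE cE subrK.
suff [s0 /step[s1 s1P]] : exists s0 : {linear P n -> P n.+1},
    forall x, res_diff P n (s0 (res_diff P n x)) = a *: res_diff P n x.
  by exists s0, s1.
elim: n => [|n [s0 /step[s1 s1P]]].
  have [f fE] : exists f : {linear P 0%N -> P 0%N}, forall x, f x = a *: x.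
    by apply: linear_of_fun => b x y; rewrite scalerDr !scalerA mulrC.
  have [x|s0 s0P] := projective_lift (d := res_diff P 0%N) (f := f) (@P_proj 0%N).
    by apply/res_exact0; rewrite fE linearZ /= aM.
  by exists s0 => x; rewrite s0P fE.
exists s1 => x; have := s1P (res_diff P n.+1 x).
have -> : res_diff P n (res_diff P n.+1 x) = 0 by apply/res_exact; exists x.
by rewrite linear0 addr0 => ->.
Qed.
End Homotopy.

Section RestrictedLucas.
Variables (A T : comNzRingType) (phi : {rmorphism A -> T}).

Definition inverts_Qideals := forall J : ideal A, Qideal J ->
  exists m (l : 'I_m -> A) (t : 'I_m -> T),
    (forall i, l i \in J) /\ \sum_i t i * phi (l i) = 1.

Lemma restr_strongly_Lucas (N : lmodType T) :
  inverts_Qideals -> strongly_Lucas (restr phi N : lmodType A).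
Proof.
move=> invQ; split.
  move=> x [J /invQ[m [l [t [lJ t1]]]] Jx].
  rewrite -[x](@scale1r T N) -t1 scaler_suml big1 // => i _.
  by rewrite -scalerA -[phi _ *: _]/(l i *: x) Jx // scaler0.
move=> J /invQ[m [l [t [lJ t1]]]] [//|n] _ P P_proj f f0 /=.
have lM i (x : quot_module J) : l i *: x = 0.
  rewrite -[x]reprK; transitivity (\pi_(quot_module J)%qT (l i *: repr x)).
    by rewrite pi_quot_scale.
  transitivity (\pi_(quot_module J)%qT 0); last exact: pi_quot0.
  apply/eqP; rewrite quot_eqE subr0 [_ *: _]mulrC; exact: rpredZ.
(* Multiplication by each [l i] is null-homotopic on [P], and so is
   [1 = \sum_i t i * phi (l i)] on [Hom(P, N)]. *)
have /choice[s0 /choice[s1 sP]] := fun i => resolution_homotopy P_proj (lM i) n.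
have [|g gE] := @linear_of_fun A (P n) (restr phi N)
    (fun y => \sum_i t i *: (f (s0 i y) : N)).
  move=> a x y; rewrite -[RHS]/(phi a *: (\sum_i t i *: (f (s0 i x) : N))
    + \sum_i t i *: (f (s0 i y) : N)) scaler_sumr -big_split; apply: eq_bigr => i _ /=.
  transitivity (t i *: (phi a *: (f (s0 i x) : N) + (f (s0 i y) : N))).
    by rewrite !linearP.
  by rewrite scalerDr !scalerA mulrC.
exists g => x; rewrite gE -[LHS](@scale1r T N) -t1 scaler_suml.
apply: eq_bigr => i _; rewrite -scalerA.
apply: (congr1 (fun z : N => t i *: z)); rewrite -[LHS]/(l i *: f x).
by rewrite -linearZ /= sP linearD /= f0 add0r.
Qed.
End RestrictedLucas.

(** * Complexes of matrices *)

Section MatrixComplexes.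
Variable T : comNzRingType.
Implicit Types N E C : lmodType T.

(** With a map from T^q to [N] written as its values on the basis, this is its composite with [w]
    mapped to [w *m M]. *)
Definition mxact N p q (M : 'M[T]_(p, q)) (v : 'I_q -> N) (i : 'I_p) : N :=
  \sum_l M i l *: v l.

Lemma mxact_mul N p q r (M : 'M[T]_(p, q)) (M' : 'M[T]_(q, r)) (v : 'I_r -> N) i :
  mxact (M *m M') v i = mxact M (mxact M' v) i.
Proof.
rewrite /mxact; under eq_bigr do rewrite mxE scaler_suml.
rewrite exchange_big; apply: eq_bigr => l _; rewrite scaler_sumr.
by apply: eq_bigr => j _; rewrite scalerA.
Qed.

Lemma mxact_linear N C (f : {linear N -> C}) p q (M : 'M[T]_(p, q)) (v : 'I_q -> N) i :
  f (mxact M v i) = mxact M (f \o v) i.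
Proof. by rewrite linear_sum; apply: eq_bigr => l _; rewrite linearZ. Qed.

Lemma mxactB N p q (M : 'M[T]_(p, q)) (v w : 'I_q -> N) i :
  mxact M (fun l => v l - w l) i = mxact M v i - mxact M w i.
Proof. by rewrite -sumrB; apply: eq_bigr => l _; rewrite scalerBr. Qed.

Lemma mxact0 N p q (M : 'M[T]_(p, q)) i : mxact M (fun=> 0 : N) i = 0.
Proof. by rewrite /mxact big1 // => l _; rewrite scaler0. Qed.

Lemma eq_mxact N p q (M : 'M[T]_(p, q)) (v w : 'I_q -> N) i :
  v =1 w -> mxact M v i = mxact M w i.
Proof. by move=> vw; apply: eq_bigr => l _; rewrite vw. Qed.

(** Exactness of Hom(-, E): the map given by [v] kills the row space of [M], hence the row kernel of
    [M'], and so extends along [M']. *)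
Lemma mxact_injective_extend E p q r (M : 'M[T]_(p, q)) (M' : 'M[T]_(q, r)) (v : 'I_q -> E) :
  injective_module E ->
  (forall w : 'rV_q, w *m M' = 0 -> exists u, w = u *m M) ->
  (forall i, mxact M v i = 0) ->
  exists e : 'I_r -> E, forall i, v i = mxact M' e i.
Proof.
move=> Einj ex Mv.
have [f fE] : exists f : {linear 'rV[T]_q -> E}, forall w, f w = mxact w v 0.
  apply: linear_of_fun => a x y; rewrite scaler_sumr -big_split.
  by apply: eq_bigr => i _; rewrite !mxE scalerDl scalerA.
have [w|g gP] := injective_extend (d := mulmxr M') (f := f) Einj.
  move=> /ex[u ->]; rewrite fE mxact_mul.
  by rewrite (eq_mxact _ _ Mv) mxact0.
exists (fun l => g (delta_mx 0 l)) => i.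
have vi : v i = f (delta_mx 0 i).
  rewrite fE /mxact (bigD1 i) //= mxE !eqxx scale1r big1 ?addr0 // => j ji.
  by rewrite mxE (negbTE ji) andbF scale0r.
rewrite vi -gP /= -rowE [row i M']row_sum_delta linear_sum.
by apply: eq_bigr => l _; rewrite linearZ !mxE.
Qed.

Variables (k : nat -> nat) (D : forall j, 'M[T]_(k j.+1, k j)).
Hypothesis D_complex : forall j, D j.+1 *m D j = 0.
Hypothesis D_exact : forall j (w : 'rV_(k j.+1)), w *m D j = 0 -> exists u, w = u *m D j.+1.

(* [H^{j+1}(Hom(T^{k}, N)) = 0], a map [T^p -> N] being a family ['I_p -> N]. *)
Definition mxcohomology_vanishes j N := forall v : 'I_(k j.+1) -> N,
  (forall i, mxact (D j.+1) v i = 0) -> exists g, forall i, v i = mxact (D j) g i.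

(** In [E], the cocycle is the coboundary of some [e]. The image of [e] in [C] is a cocycle, hence a
    coboundary of some [h]; correcting [e] by a lift of [h] moves it into [N]. *)
Lemma mxcohomology_shift j N E C (i : {linear N -> E}) (p : {linear E -> C}) :
  injective_module E -> injective i -> (forall c, exists e, p e = c) ->
  (forall e, p e = 0 <-> exists n, i n = e) ->
  mxcohomology_vanishes j C -> mxcohomology_vanishes j.+1 N.
Proof.
move=> Einj i_inj p_surj pi HC v Dv.
have [||e eP] := mxact_injective_extend (M := D j.+2) (M' := D j.+1) (v := i \o v) Einj.
- exact: D_exact.
- by move=> l; rewrite -mxact_linear Dv linear0.
have [|h hP] := HC (p \o e).
  by move=> l; rewrite -mxact_linear -eP; apply/pi; exists (v l).
have /choice[h' h'P] : forall l, exists h', p h' = h l by move=> l.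
have /choice[m mP] : forall l, exists m, i m = e l - mxact (D j) h' l.
  move=> l; apply/pi; rewrite linearB /= mxact_linear.
  by have /= -> := hP l; rewrite -(eq_mxact _ _ h'P) subrr.
exists m => l; apply: i_inj; rewrite mxact_linear (eq_mxact _ _ mP).
rewrite mxactB -[i (v l)]/((i \o v) l) eP -mxact_mul D_complex.
by rewrite /mxact [X in _ - X]big1 ?subr0 // => s _; rewrite mxE scale0r.
Qed.

(** For [N] the row space of [D j], the matrix [D j] itself is a cocycle with values in [N]. It is
    then [D j] followed by a map [g] into [N]; writing the values of [g] as combinations of rows of
    [D j] gives [U]. *)
Lemma mxcohomology_regular j :
  (forall N, mxcohomology_vanishes j N) -> exists U, D j = D j *m U *m D j.
Proof.
have [||N [i [i_inj iP]]] := @submodule_exists T 'rV[T]_(k j)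
    (fun w => exists u, w = u *m D j).
- by exists 0; rewrite mul0mx.
- by move=> a _ _ [u ->] [u' ->]; exists (a *: u + u'); rewrite mulmxDl scalemxAl.
move=> /(_ N) HN.
have /choice[v vP] : forall l, exists v, i v = row l (D j).
  by move=> l; apply/iP; exists (delta_mx 0 l); rewrite rowE.
have rowsE p q r (M : 'M[T]_(p, q)) (M' : 'M[T]_(q, r)) l :
    mxact M (fun s => row s M') l = row l (M *m M').
  apply/rowP => s; rewrite summxE !mxE; apply: eq_bigr => t _; by rewrite !mxE.
have [|g gP] := HN v.
  move=> l; apply: i_inj; rewrite mxact_linear (eq_mxact _ _ vP) rowsE D_complex.
  by rewrite !linear0.
have /choice[u uP] : forall l, exists u, i (g l) = u *m D j.
  by move=> l; apply/iP; exists (g l).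
exists (\matrix_l u l); apply/row_matrixP => l.
rewrite -vP gP mxact_linear -mulmxA -rowsE; apply: eq_mxact => s /=.
by rewrite uP row_mul rowK.
Qed.
End MatrixComplexes.

(** * Bass: split injections of free modules and descent of regularity *)

Section Bass.
Variable T : comNzRingType.

Definition dense_family n (c : 'I_n -> T) := forall y, (forall i, y * c i = 0) -> y = 0.

(** In other words, a finitely generated proper ideal has a nonzero annihilator. *)
Definition fg_dense_improper := forall n (t : 'I_n -> T), dense_family t ->
  exists u : 'I_n -> T, \sum_i u i * t i = 1.

Hypothesis improper : fg_dense_improper.

(** Induction on the rows. Injectivity makes the entries of the first row [g] a dense family, so
    [g *m c = 1] for some column [c]; the other rows, projected along [g] into the kernel of [c],
    still form an injective matrix [G2]. *)
Lemma mx_right_inverse p q (G : 'M[T]_(p, q)) :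
  (forall v : 'rV_p, v *m G = 0 -> v = 0) -> exists B, G *m B = 1%:M.
Proof.
elim: p G => [|p IH] G G_inj.
  by exists 0; apply/matrixP => -[].
move: G G_inj; rewrite -[p.+1]/(1 + p)%N => G G_inj.
pose g := usubmx G; pose G1 := dsubmx G.
have GE : G = col_mx g G1 by rewrite vsubmxK.
have [x gx|u u1] := @improper q (fun j => g 0 j).
  have /(congr1 (fun v : 'rV_(1 + p) => v 0 (lshift p 0))) : row_mx x%:M (0 : 'rV_p) = 0.
    apply: G_inj; rewrite GE mul_row_col mul0mx addr0 mul_scalar_mx.
    by apply/matrixP => i j; rewrite [RHS]mxE [LHS]mxE [i]ord1 gx.
  by rewrite row_mxEl !mxE eqxx.
pose c : 'cV[T]_q := \col_j u j.
have gc : g *m c = 1%:M.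
  apply/matrixP => i j; rewrite !ord1 !mxE eqxx -u1.
  by apply: eq_bigr => l _; rewrite !mxE mulrC.
pose G2 := G1 - G1 *m c *m g.
have G2c : G2 *m c = 0 by rewrite mulmxBl -[_ *m g *m c]mulmxA gc mulmx1 subrr.
have [v G2v|B2 G2B] := IH G2.
  have /(congr1 (fun v : 'rV_(1 + p) => rsubmx v)) : row_mx (- (v *m G1 *m c)) v = 0.
    apply: G_inj; rewrite GE mul_row_col mulNmx addrC.
    by rewrite -G2v mulmxBr !mulmxA.
  by rewrite row_mxKr => ->; apply/rowP => i; rewrite !mxE.
(* [B3] and [c'] correct [B2] and [c] so that the off-diagonal blocks of the product vanish. *)
pose B3 := B2 - c *m (g *m B2).
have gB3 : g *m B3 = 0 by rewrite mulmxBr (mulmxA g c) gc mul1mx subrr.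
have G1B3 : G1 *m B3 = 1%:M.
  have -> : G1 = G2 + G1 *m c *m g by rewrite subrK.
  rewrite mulmxDl -[_ *m g *m B3]mulmxA gB3 mulmx0 addr0.
  by rewrite mulmxBr G2B (mulmxA G2 c) G2c mul0mx subr0.
pose c' := c - B3 *m (G1 *m c).
have gc' : g *m c' = 1%:M by rewrite mulmxBr gc (mulmxA g B3) gB3 mul0mx subr0.
have G1c' : G1 *m c' = 0 by rewrite mulmxBr (mulmxA G1 B3) G1B3 mul1mx subrr.
by exists (row_mx c' B3); rewrite GE mul_col_row gc' gB3 G1c' G1B3 -scalar_mx_block.
Qed.

(** The idempotent [f = U *m M'] projects onto the row space of [M'], which is the row kernel of
    [M]. A right inverse of [row_mx M f], multiplied by [1 - f], yields [U] with [M *m U = 1 - f],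
    and [(1 - f) *m M = M]. *)
Lemma regular_mx_step p q r (M' : 'M[T]_(p, q)) (M : 'M[T]_(q, r)) :
  M' *m M = 0 -> (forall w : 'rV_q, w *m M = 0 -> exists u, w = u *m M') ->
  (exists U, M' = M' *m U *m M') -> exists U, M = M *m U *m M.
Proof.
move=> M'M ex [U M'U]; pose f := U *m M'.
have ff : f *m f = f by rewrite /f -!mulmxA (mulmxA M') -M'U.
have fM : f *m M = 0 by rewrite -mulmxA M'M mulmx0.
(* [M] and [f] have complementary row kernels. *)
have [v|B] := @mx_right_inverse _ _ (row_mx M f).
  rewrite mul_mx_row -row_mx0 => /eq_row_mx[/ex[u ->]].
  by rewrite -mulmxA /f (mulmxA M') -M'U.
have eM : (1%:M - f) *m M = M by rewrite mulmxBl mul1mx fM subr0.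
have ef : (1%:M - f) *m f = 0 by rewrite mulmxBl mul1mx ff subrr.
rewrite -[B]vsubmxK mul_row_col => /(congr1 (fun X => (1%:M - f) *m X)).
rewrite mulmx1 mulmxDr (mulmxA _ M) (mulmxA _ f) eM ef mul0mx addr0 => MB.
by exists (usubmx B); rewrite MB eM.
Qed.
End Bass.

(** * Finite dimension implies regularity *)

Section FiniteDimension.
Variables (A T : comNzRingType) (phi : {rmorphism A -> T}).
Hypothesis phi_flat : flat_morphism phi.

(** The index [j] refers to H^{j+1}(Hom(P, N)), in step with [mxcohomology_vanishes]. *)
Definition cohomology_vanishes (M : lmodType A) (P : resolution M) j (N : lmodType A) :=
  forall f : {linear P j.+1 -> N}, cocycle f -> coboundary f.

(** This shift goes opposite to [mxcohomology_shift], from [N] to [C]. A cocycle [f] lifts to [h]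
    with values in [E]; its coboundary lies in [N] and has a primitive [g] there, so [h - i g] is a
    cocycle in [E], hence a coboundary. *)
Lemma cohomology_shift (M : lmodType A) (P : resolution M) j (N E C : lmodType A)
    (i : {linear N -> E}) (p : {linear E -> C}) :
  injective_module E -> injective i -> (forall c, exists e, p e = c) ->
  (forall e, p e = 0 <-> exists n, i n = e) -> Ext1_vanishes (P j.+1) N ->
  cohomology_vanishes P j.+1 N -> cohomology_vanishes P j C.
Proof.
move=> Einj i_inj p_surj pi ExtP HN f f0.
have [h hP] := Ext1_lift ExtP i_inj p_surj pi f.
have [hd hdE] : exists hd : {linear P j.+2 -> E}, forall x, hd x = h (res_diff P j.+1 x).
  by apply: linear_of_fun => a x y; rewrite !linearP.
have [|f2 f2P] := linear_corestrict (f := hd) i_inj.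
  by move=> x; apply/pi; rewrite hdE hP f0.
have [|g gP] := HN f2.
  move=> x; apply: i_inj; rewrite f2P hdE linear0.
  have -> : res_diff P j.+1 (res_diff P j.+2 x) = 0 by apply/res_exact; exists x.
  by rewrite linear0.
have [h3 h3E] : exists h3 : {linear P j.+1 -> E}, forall x, h3 x = h x - i (g x).
  apply: linear_of_fun => a x y.
  by rewrite linearP [g _]linearP [i (_ + _)]linearP scalerBr opprD addrACA.
have [|e eP] := injective_extend (d := res_diff P j) (f := h3) Einj.
  by move=> x /res_exact[y <-]; rewrite h3E -hdE -f2P gP subrr.
exists (p \o e) => x /=; rewrite eP h3E linearB /= hP.
by rewrite [p (i _)](iffRL (pi _)) ?subr0 //; exists (g x).
Qed.

Variables (k : nat -> nat) (D : forall j, 'M[T]_(k j.+1, k j)) (a : A).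
Hypothesis D_complex : forall j, D j.+1 *m D j = 0.
Hypothesis D_exact : forall j (w : 'rV_(k j.+1)), w *m D j = 0 -> exists u, w = u *m D j.+1.
(** The premise on [N] is what Ext^1(A/aA, N) = 0 provides. *)
Hypothesis D0 : forall N : lmodType T,
  (forall n : N, (forall t, t * phi a = 0 -> t *: n = 0) -> exists g, n = phi a *: g) ->
  mxcohomology_vanishes D 0 N.
Hypothesis T_improper : fg_dense_improper T.

(** Apply finiteness to [A/aA]. In a resolution [P] of length [n], H^{n+1}(Hom(P, N)) vanishes for
    all [N]; shifting down to H^1 along [P] and back up along [D] makes [D n] regular, and
    regularity descends to [D 0]. *)
Lemma finite_dimension_regular (X : lmodType A -> Prop) d :
  (forall P, X P -> forall N : lmodType T, Ext1_vanishes P (restr phi N)) ->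
  (forall M : lmodType A, exists2 n, (n <= d)%N & has_finite_resolution X M n) ->
  exists U, D 0 = D 0 *m U *m D 0.
Proof.
move=> XExt fin.
have [||M [pi [pi_surj piP]]] := @quotient_exists A A^o (fun x => exists c, c * a = x).
- by exists 0; rewrite mul0r.
- by move=> b _ _ [c <-] [c' <-]; exists (b * c + c'); rewrite mulrDl -mulrA.
have [n _ [P [PX P0]]] := fin M.
have shift j : (j <= n)%N -> forall N : lmodType T,
    cohomology_vanishes P j (restr phi N) -> mxcohomology_vanishes D j N.
  elim: j => [_ N HN|j IH jn N HN].
    (* Ext^1(A/aA, N) = 0 is applied to the presentation by multiplication by [a] on [A], and to the
       map sending [c] to [phi c *: m]. *)
    apply: D0 => m am.
    have ExtM : Ext1_vanishes M (restr phi N).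
      by apply: (Ext1_of_resolution (P := P)); [apply: XExt; apply: PX | exact: HN].
    have [mula mulaE] : exists f : {linear A^o -> A^o}, forall c, f c = c * a.
      by apply: linear_of_fun => b c c'; rewrite mulrDl -mulrA.
    have [mulm mulmE] : exists f : {linear A^o -> restr phi N}, forall c, f c = phi c *: m.
      by apply: linear_of_fun => b c c'; rewrite rmorphD rmorphM scalerDl -scalerA.
    have [||c|g gP] := ExtM _ _ mula pi _ _ mulm.
    - exact: pi_surj.
    - by move=> x; rewrite piP; split=> -[c cx]; exists c; rewrite -cx ?mulaE.
    - by rewrite mulaE mulmE => ca; apply: am; rewrite -rmorphM ca rmorph0.
    exists (g 1); have := gP 1; rewrite mulaE mulmE mul1r rmorph1 scale1r => <-.
    by rewrite -[a in LHS]mulr1 -[a * 1]/(a *: (1 : A^o)) linearZ.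
  have [E [i [Einj i_inj]]] := enough_injectives N.
  have [||C [p [p_surj pP]]] := @quotient_exists T E (fun e => exists n, i n = e).
  - by exists 0; rewrite linear0.
  - by move=> b _ _ [x <-] [y <-]; exists (b *: x + y); rewrite linearP.
  apply: (mxcohomology_shift D_complex D_exact Einj i_inj p_surj pP).
  apply: (IH (ltnW jn)).
  have [i' i'E] := restr_linear phi i; have [p' p'E] := restr_linear phi p.
  apply: (cohomology_shift (i := i') (p := p') _ _ _ _ _ HN).
  - exact: restr_injective.
  - by move=> x y; rewrite !i'E; apply: i_inj.
  - by move=> c; have [e ec] := p_surj c; exists e; rewrite p'E.
  - by move=> e; rewrite p'E pP; split=> -[x xe]; exists x; rewrite -xe i'E.
  - by apply: XExt; apply: PX.
have reg : exists U, D n = D n *m U *m D n.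
  apply: (mxcohomology_regular D_complex) => N; apply: shift => // f _.
  have [|z _] := @linear_of_fun A (P n) (restr phi N) (fun=> 0).
    by move=> *; rewrite scaler0 addr0.
  by exists z => x; rewrite (P0 _ (ltnSn n) x) !linear0.
elim: n {P PX P0 shift} reg => // n IH reg; apply: IH.
exact: (regular_mx_step T_improper (D_complex n) (D_exact (j := n)) reg).
Qed.
End FiniteDimension.

(** * Syzygies over tau_q-Noetherian rings *)

Lemma tauq_Noetherian_ideal (R : comNzRingType) (S : R -> Prop) :
  tauq_Noetherian R -> S 0 -> (forall a x y, S x -> S y -> S (a * x + y)) ->
  exists n (a : 'I_n -> R), (forall i, S (a i)) /\
    forall x, S x -> exists2 L : ideal R, Qideal L &
      forall l, l \in L -> exists c : 'I_n -> R, l * x = \sum_i c i * a i.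
Proof.
move=> RN S0 SL; have [I IP] := @submod_of_pred R R^o S S0 SL.
have [n [f ftor]] := RN I.
exists n, (fun i => val (f (delta_mx 0 i))); split=> [i|x /IP xI].
  by apply/IP; case: (f _).
pose x' : submod_carrier I := SubmodCarrier xI.
have [L LQ Lx] := ftor (\pi_(quot_module (image_pred f))%qT x').
exists L => // l /Lx /eqP.
have -> : l *: \pi_(quot_module (image_pred f))%qT x'
      = \pi_(quot_module (image_pred f))%qT (l *: x').
  by rewrite pi_quot_scale.
rewrite -[0 in X in X -> _](@pi_quot0 R _ (image_pred f)) quot_eqE subr0 => /asboolP[v fv].
exists (v 0); rewrite -[LHS]/(val (l *: x')) -fv {1}[v]row_sum_delta !linear_sum.
by apply: eq_bigr => i _; rewrite linearZ linearZ.
Qed.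

Section Syzygies.
Variables (R T : comNzRingType) (phi : {rmorphism R -> T}).
Hypotheses (R_Noetherian : tauq_Noetherian R) (phi_flat : flat_morphism phi)
  (phi_inverts : inverts_Qideals phi).

(** Induction on [p]: the first coordinates form an ideal, and the vectors of [S] with first
    coordinate 0 a submodule of smaller rank. The ideal is generated only up to multiplication by
    some [J] in Q, but [J] becomes the unit ideal over [T]. *)
Lemma submodule_fg_over_T p (S : 'rV[R]_p -> Prop) :
  S 0 -> (forall a x y, S x -> S y -> S (a *: x + y)) ->
  exists m (L : 'M[R]_(m, p)), (forall i, S (row i L)) /\
    forall v, S v -> exists u : 'rV[T]_m, map_mx phi v = u *m map_mx phi L.
Proof.
elim: p S => [|p IH] S S0 SL.
  exists 0%N, 0; split=> [[]//|v _]; exists 0.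
  by apply/matrixP => i [].
move: S S0 SL; rewrite -[p.+1]/(1 + p)%N => S S0 SL.
have SZ b x : S x -> S (b *: x) by move=> Sx; rewrite -[_ *: _]addr0; apply: SL.
have SD x y : S x -> S y -> S (x + y).
  by move=> Sx Sy; rewrite -[x]scale1r; apply: SL.
have [||n [a [aS aP]]] := @tauq_Noetherian_ideal R
    (fun x => exists w : 'rV[R]_p, S (row_mx x%:M w)) R_Noetherian.
- by exists 0; rewrite raddf0 row_mx0.
- move=> b x y [w Sw] [w' Sw']; exists (b *: w + w').
  by rewrite raddfD /= -scale_scalar_mx -add_row_mx -scale_row_mx; apply: SL.
have /choice[w wS] := aS.
have [||m [L' [L'S L'P]]] := IH (fun w => S (row_mx 0 w)).
- by rewrite row_mx0.
- move=> b x y Sx Sy; have := SL b _ _ Sx Sy.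
  by rewrite scale_row_mx add_row_mx scaler0 addr0.
pose L1 : 'M[R]_(n, 1 + p) := \matrix_i row_mx (a i)%:M (w i).
exists (n + m)%N, (col_mx L1 (row_mx 0 L')); split.
  move=> i; case: (split_ordP i) => j ->.
    by rewrite rowKu rowK.
  by rewrite rowKd row_row_mx row0.
move=> v Sv; pose x := v 0 (lshift p 0).
have vE : v = row_mx x%:M (rsubmx v).
  rewrite -[LHS]hsubmxK; congr row_mx.
  by apply/matrixP => i j; rewrite !ord1 !mxE eqxx.
have [|J /phi_inverts[r [l [t [lJ t1]]]] Jx] := aP x.
  by exists (rsubmx v); rewrite -vE.
have /choice[u uP] : forall i, exists u : 'rV[T]_(n + m),
    phi (l i) *: map_mx phi v = u *m map_mx phi (col_mx L1 (row_mx 0 L')).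
  move=> i; have [c cE] := Jx _ (lJ i).
  (* Subtracting a combination of rows of [L1] clears the first coordinate of [l i *: v]. *)
  pose cv := \row_j c j; pose z := l i *: v - cv *m L1.
  have Sz : S z.
    apply: (SD _ _ (SZ _ _ Sv)); rewrite -scaleN1r; apply: (SZ); rewrite mulmx_sum_row.
    apply: big_ind => [//|y y' Sy Sy'|j _]; first exact: SD.
    by apply: SZ; rewrite rowK.
  have zE : z = row_mx 0 (rsubmx z).
    rewrite -[LHS]hsubmxK; congr row_mx; apply/matrixP => i' j.
    rewrite !ord1 [LHS]mxE [RHS]mxE mxE [X in X + _]mxE -/x cE [X in _ + X]mxE.
    apply/eqP; rewrite [X in _ - X]mxE subr_eq0; apply/eqP; apply: eq_bigr => s _.
    by rewrite [cv _ _]mxE [L1 _ _]mxE row_mxEl mxE eqxx.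
  have [u' u'E] : exists u' : 'rV[T]_m, map_mx phi (rsubmx z) = u' *m map_mx phi L'.
    by apply: L'P; rewrite -zE.
  exists (row_mx (map_mx phi cv) u').
  rewrite map_col_mx mul_row_col map_row_mx mul_mx_row map_mx0 mulmx0 -u'E.
  rewrite -(map_mx0 phi) -map_row_mx -zE -map_mxM -map_mxD addrC subrK.
  by rewrite map_mxZ.
exists (\sum_i t i *: u i).
rewrite mulmx_suml -[LHS]scale1r -t1 scaler_suml; apply: eq_bigr => i _.
by rewrite -scalerA uP scalemxAl.
Qed.

(** By flatness, syzygies over [T] are combinations of syzygies over [R]. The new matrix again has
    entries in [R], which permits iteration. *)
Lemma syzygies_over_T p q (M : 'M[R]_(p, q)) :
  exists s : {m & 'M[R]_(m, p)}, projT2 s *m M = 0 /\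
    forall w : 'rV[T]_p, w *m map_mx phi M = 0 -> exists u, w = u *m map_mx phi (projT2 s).
Proof.
have [||m [L [LM LP]]] := @submodule_fg_over_T p (fun v => v *m M = 0).
- by rewrite mul0mx.
- by move=> b x y xM yM; rewrite mulmxDl -scalemxAl xM yM scaler0 addr0.
exists (existT _ m L); split=> /=.
  by apply/row_matrixP => i; rewrite row_mul LM row0.
move=> w /phi_flat[r [u [L0 [L0M ->]]]].
have /choice[v vP] : forall i, exists v, map_mx phi (row i L0) = v *m map_mx phi L.
  by move=> i; apply: LP; rewrite -row_mul L0M row0.
exists (u *m \matrix_i v i); rewrite -mulmxA; congr (_ *m _).
by apply/row_matrixP => i; rewrite row_mul rowK -vP map_row.
Qed.

Lemma principal_resolution (b : R) :
  exists (k : nat -> nat) (D : forall j, 'M[T]_(k j.+1, k j)),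
  [/\ forall j, D j.+1 *m D j = 0,
      forall j (w : 'rV_(k j.+1)), w *m D j = 0 -> exists u, w = u *m D j.+1,
      forall N : lmodType T,
        (forall n : N, (forall t, t * phi b = 0 -> t *: n = 0) -> exists g, n = phi b *: g) ->
        mxcohomology_vanishes D 0 N
    & (exists U, D 0 = D 0 *m U *m D 0) -> exists u, phi b = phi b * u * phi b].
Proof.
pose state := {p & {q & 'M[R]_(p, q)}}.
pose mat (s : state) : 'M[R]_(projT1 s, projT1 (projT2 s)) := projT2 (projT2 s).
pose syz (s : state) := sval (cid (syzygies_over_T (mat s))).
(* The row count of one matrix becomes the column count of the next. *)
pose step (s : state) : state :=
  existT _ (projT1 (syz s)) (existT _ (projT1 s) (projT2 (syz s))).
pose s0 : state := existT _ 1%N (existT _ 1%N (b%:M)).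
pose s j := iter j step s0.
pose k j := projT1 (projT2 (s j)).
pose D j : 'M[T]_(k j.+1, k j) := map_mx phi (mat (s j)).
have ex j (w : 'rV_(k j.+1)) : w *m D j = 0 -> exists u, w = u *m D j.+1.
  have [_] := svalP (cid (syzygies_over_T (mat (s j)))); exact.
exists k, D; split=> //.
- move=> j; rewrite -map_mxM -[RHS](map_mx0 phi); congr map_mx.
  by have [] := svalP (cid (syzygies_over_T (mat (s j)))).
- move=> N bN v D1v; have [t tb|g gP] := bN (v 0).
    (* An annihilator [t] of [phi b] is a combination of rows of [D 1], which kill the cocycle
       [v]. *)
    have [|u tu] := ex 0%N t%:M.
      rewrite /D /mat /= map_scalar_mx; apply/matrixP => i j.
      by rewrite mul_scalar_mx !mxE; case: eqP => // _; rewrite ?mulr1n ?mulr0n ?mulr0.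
    have : mxact t%:M v 0 = 0 :> N by rewrite tu mxact_mul (eq_mxact _ _ D1v) mxact0.
    by rewrite /mxact big_ord1 mxE eqxx.
  exists (fun=> g) => i; rewrite [i]ord1 /mxact gP.
  by rewrite big_ord1 !mxE eqxx.
- move=> [U DU]; exists (U 0 0).
  have := congr1 (fun X : 'M_1 => X 0 0) DU; rewrite /D /mat /= map_scalar_mx.
  by rewrite mul_scalar_mx mul_mx_scalar !mxE eqxx mulr1n => {1}->; rewrite mulrC.
Qed.
End Syzygies.

(** * Dimensions and the reduced case *)

Section Dimensions.
Variables (A : comNzRingType) (X : lmodType A -> Prop).

Lemma zero_linear_exists (U V : lmodType A) : exists z : {linear U -> V}, z =1 fun=> 0.
Proof. by apply: linear_of_fun => *; rewrite scaler0 addr0. Qed.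

Lemma finite_resolution0 M : X M -> has_finite_resolution X M 0.
Proof.
move=> XM; pose P i : lmodType A := if i is 0 then M else 'rV[A]_0.
pose d i : {linear P i.+1 -> P i} := sval (cid (zero_linear_exists _ _)).
have dE i x : d i x = 0 by exact: (svalP (cid (zero_linear_exists _ _))).
have P0 i (x y : P i.+1) : x = y by apply/rowP => -[].
have [F FE] : exists F : resolution M, (F : nat -> lmodType A) = P.
  pose aug : {linear P 0%N -> M} := idfun.
  have aug_surj m : exists x, aug x = m by exists m.
  have e0 x : aug x = 0 <-> exists y, d 0%N y = x.
    by split=> [x0|[y <-]]; [exists 0; rewrite dE; exact: esym x0 | rewrite dE].
  have e i x : d i x = 0 <-> exists y, d i.+1 y = x.
    by split=> [_|_]; [exists 0; exact: P0 | exact: dE].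
  by exists (@Resolution A M P d aug aug_surj e0 e).
exists F; rewrite FE; split=> [[|i]//|[|i] // _ x]; exact: P0.
Qed.

Lemma gldim_wrt_eq0 : (forall M, X M) -> gldim_wrt X = Some 0.
Proof.
move=> XM; have dim0 M : dim_wrt X M = Some 0.
  rewrite /dim_wrt /enat_least; case: pselect => [ex|[]]; last first.
    by exists 0; apply/asboolP/finite_resolution0.
  congr Some; case: ex_minnP => n _ /(_ 0); rewrite leqn0 => n0; apply/eqP/n0.
  exact/asboolP/finite_resolution0.
have sup0 : `[< forall a, (exists M : lmodType A, a = dim_wrt X M) -> enat_le a (Some 0) >].
  by apply/asboolP => _ [M ->]; rewrite dim0.
rewrite /gldim_wrt /enat_sup /enat_least; case: pselect => [ex|[]]; last by exists 0.
by congr Some; case: ex_minnP => n _ /(_ 0 sup0); rewrite leqn0 => /eqP.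
Qed.

Lemma gldim_wrt_finite d : gldim_wrt X = Some d ->
  forall M, exists2 n, (n <= d)%N & has_finite_resolution X M n.
Proof.
rewrite /gldim_wrt /enat_sup {1}/enat_least; case: pselect => // ex [dE] M.
have : enat_le (dim_wrt X M) (Some d).
  move: dE; case: ex_minnP => m /asboolP Hm _ <-; apply: Hm; by exists M.
rewrite /dim_wrt /enat_least; case: pselect => //= ex1.
by case: ex_minnP => n /asboolP Hn _ nd; exists n.
Qed.
End Dimensions.

(** * Injectivity from annihilator splittings *)

Section Reduced.
Variable A : comNzRingType.

Definition is_reduced := forall x : A, x * x = 0 -> x = 0.

Definition is_ideal (S : A -> Prop) :=
  S 0 /\ forall a x y, S x -> S y -> S (a * x + y).

(* [S + Ann S] contains a finitely generated dense ideal. *)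
Definition annihilator_splits (S : A -> Prop) :=
  exists n (c x z : 'I_n -> A), dense_family c /\
    forall i, [/\ c i = x i + z i, S (x i) & forall y, S y -> z i * y = 0].

Lemma Qideal_of_dense_family n (c : 'I_n -> A) : dense_family c ->
  exists J : ideal A, [/\ Qideal J, forall i, c i \in J
    & forall x, x \in J -> exists u : 'I_n -> A, x = \sum_i u i * c i].
Proof.
move=> c_dense; have [||J JP] := @submod_of_pred A A^o
    (fun x => exists u : 'I_n -> A, x = \sum_i u i * c i).
- by exists (fun=> 0); rewrite big1 // => i _; rewrite mul0r.
- move=> a _ _ [u ->] [v ->]; exists (fun i => a * u i + v i).
  rewrite scaler_sumr -big_split; apply: eq_bigr => i _.
  by rewrite mulrDl -mulrA.
have cJ i : c i \in J.
  apply/JP; exists (fun j => (j == i)%:R); rewrite (bigD1 i) //= eqxx mul1r.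
  by rewrite big1 ?addr0 // => j /negbTE ->; rewrite mul0r.
exists J; split=> // [|x /JP //].
have Jfg : fg_ideal J by exists n, c.
split=> //; exists J; split=> // r Jr; apply: c_dense => i.
by rewrite mulrC; apply: Jr.
Qed.

Lemma Qideal_generators (J : ideal A) : Qideal J ->
  exists n (a : 'I_n -> A), dense_family a /\ forall i, a i \in J.
Proof.
move=> [[n [a JP]] [J' [_ J'_dense J'J]]]; exists n, a; split=> [y ya|i].
  apply: J'_dense => x /J'J/JP[u ->]; rewrite mulr_suml big1 // => j _.
  by rewrite -mulrA [_ * y]mulrC ya mulr0.
apply/JP; exists (fun j => (j == i)%:R); rewrite (bigD1 i) //= eqxx mul1r.
by rewrite big1 ?addr0 // => j /negbTE ->; rewrite mul0r.
Qed.

Hypothesis A_reduced : is_reduced.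
Hypothesis A_splits : forall S, is_ideal S -> annihilator_splits S.

(** Baer's criterion: on the dense ideal [J] inside [S + Ann S], the extension of [G] by 0 is
    linear, and Ext^1(A/J, N) = 0 extends it to all of [A]. Its value at 1 agrees with [G] after
    multiplication by each [c i], hence agrees. *)
Lemma split_injective (N : lmodType A) :
  (forall n (c : 'I_n -> A) (y : N), dense_family c -> (forall i, c i *: y = 0) -> y = 0) ->
  (forall J : ideal A, Qideal J -> Ext1_vanishes (quot_module J) N) ->
  injective_module N.
Proof.
move=> N_tf N_ext; apply: baer_criterion => G GG; have [G0 GL G00] := GG.
pose S x := exists y, G x y; pose Ann z := forall y, S y -> z * y = 0.
have [|n [c [x [z [c_dense cP]]]]] := A_splits (S := S).
  split; first by exists 0.
  by move=> a u v [y Gy] [y' Gy']; exists (a *: y + y'); apply: GL.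
have [J [JQ cJ JP]] := Qideal_of_dense_family c_dense.
have split_J j : j \in J -> exists u v, [/\ j = u + v, S u & Ann v].
  move=> /JP[w ->]; exists (\sum_i w i * x i), (\sum_i w i * z i); split.
  - rewrite -big_split; apply: eq_bigr => i _ /=; rewrite -mulrDr.
    by have [-> _ _] := cP i.
  - apply: big_ind => [|u v [y Gy] [y' Gy']|i _]; first by exists 0.
      by exists (y + y'); apply: (linear_graphD GG).
    by have [_ [y Gy] _] := cP i; exists (w i *: y); apply: (linear_graphZ _ GG Gy).
  - move=> y Sy; rewrite mulr_suml big1 // => i _.
    by have [_ _ zy] := cP i; rewrite -mulrA zy // mulr0.
have [d dE] : exists d : {linear submod_carrier J -> A^o}, forall k, d k = val k.
  by apply: linear_of_fun => a u v; rewrite linearP.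
have [p pE] : exists p : {linear A^o -> quot_module J},
    forall v, p v = \pi_(quot_module J)%qT v.
  by apply: linear_of_fun => a u v; rewrite pi_quot_add pi_quot_scale.
(* Extend [G] by [0] on [Ann S]: this is single valued because the elements of
   [S] annihilating [S] square to [0]. *)
have [||f fP] := @linear_of_graph A (submod_carrier J) N
    (fun k y => exists u v, [/\ val k = u + v, Ann v & G u y]).
- split.
  + exists 0, 0; rewrite linear0 addr0; split=> // y _; by rewrite mul0r.
  + move=> a k y k' y' [u [v [kE vA Gu]]] [u' [v' [kE' vA' Gu']]].
    exists (a * u + u'), (a * v + v'); split; last exact: GL.
      rewrite (_ : val (a *: k + k') = a *: val k + val k'); last exact: linearP.
      by rewrite kE kE' scalerDr addrACA.
    by move=> h Sh; rewrite mulrDl -mulrA vA // vA' // mulr0 addr0.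
  + move=> y [u [v [/esym/eqP]]]; rewrite linear0 addr_eq0 => /eqP uE vA Gu.
    have u0 : u = 0.
      by apply: A_reduced; rewrite {1}uE mulNr vA ?oppr0 //; exists y.
    by apply: G00; rewrite -u0.
- move=> k; have [|u [v [kE [y Gy] vA]]] := split_J (val k); first by case: k.
  by exists y, u, v.
have [|v|k|g gP] := N_ext J JQ _ _ d p _ _ f.
- by move=> q; exists (repr q); rewrite pE reprK.
- rewrite pE -(pi_quot0 J); split=> [/eqP|[k <-]].
    by rewrite quot_eqE subr0 => vJ; exists (SubmodCarrier vJ); rewrite dE.
  by apply/eqP; rewrite quot_eqE subr0 dE; case: k.
- by rewrite dE => k0; rewrite (_ : k = 0) ?linear0 //; apply: val_inj; rewrite k0 linear0.
exists (g 1) => h y Gh; apply/eqP; rewrite -subr_eq0; apply/eqP.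
apply: (N_tf _ c _ c_dense) => i.
have [u [v [ciE vA Gu]]] := fP (SubmodCarrier (cJ i)); rewrite /= in ciE.
have fE : f (SubmodCarrier (cJ i)) = c i *: g 1.
  by rewrite -gP dE -linearZ /= [_ *: _]mulr1.
rewrite fE in Gu; rewrite scalerBr {1}ciE scalerDl.
have -> : v *: y = 0.
  apply: G00; rewrite -(vA h); last by exists y.
  exact: (linear_graphZ v GG Gh).
rewrite addr0; apply/eqP; rewrite subr_eq0 scalerA mulrC -scalerA; apply/eqP.
(* Both sides are values of [G] at [u * h]. *)
apply: (linear_graph_fun GG (x := u * h)); first exact: (linear_graphZ u GG Gh).
rewrite mulrC; exact: (linear_graphZ h GG Gu).
Qed.

Lemma reduced_tauq_projective (M : lmodType A) : tauq_projective M.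
Proof.
move=> N [N_tf N_ext]; apply/Ext1_vanishesP/injective_Ext1/split_injective.
  move=> n c y /Qideal_of_dense_family[J [JQ cJ JP]] cy; apply: N_tf.
  exists J => // a /JP[u ->]; rewrite scaler_suml big1 // => i _.
  by rewrite -scalerA cy scaler0.
by move=> J JQ; apply/Ext1_vanishesP/N_ext.
Qed.

(** Here [A/J = 0] for every [J] in Q, so every module is injective; in particular the kernel of [g]
    is, and [f] lifts. *)
Lemma reduced_improper_projective (M : lmodType A) : fg_dense_improper A -> projective M.
Proof.
move=> improper B C g f g_surj.
have [||N [i [i_inj iP]]] := @submodule_exists A B (fun b => g b = 0).
- by rewrite linear0.
- by move=> a x y gx gy; rewrite linearP gx gy scaler0 addr0.
apply: (Ext1_lift _ i_inj g_surj iP f); apply/injective_Ext1/split_injective.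
  move=> n c y /improper[u u1] cy; rewrite -[y]scale1r -u1 scaler_suml big1 // => j _.
  by rewrite -scalerA cy scaler0.
move=> J /Qideal_generators[n [c [/improper[u u1] cJ]]]; apply: trivial_Ext1 => m.
rewrite -[m]reprK -(pi_quot0 J); apply/eqP; rewrite quot_eqE subr0.
rewrite -[repr m]scale1r -u1 scaler_suml; apply: rpred_sum => j _.
by rewrite -[_ *: _]/(u j * c j * (repr m : A)) mulrAC; apply: (rpredZ (u j * _) (cJ j)).
Qed.
End Reduced.

(** * The total ring of quotients of a polynomial ring *)

Lemma lreg_of_annihilator (S : comNzRingType) (g : S) :
  (forall h, h * g = 0 -> h = 0) -> GRing.lreg g.
Proof.
move=> g0 x y /eqP; rewrite -subr_eq0 -mulrBr mulrC => /eqP/g0/eqP.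
by rewrite subr_eq0 => /eqP.
Qed.

Section McCoy.
Variable R : comNzRingType.
Implicit Types (f g : {poly R}).

(** Induction on the size of [g]. If its leading coefficient does not kill [f i], take the largest
    [j] such that the coefficient [(f i)]_j[does not kill]g[; the product](f i)[_j *: g] still kills
    the family and has smaller size. *)
Lemma McCoy n (f : 'I_n -> {poly R}) g : g != 0 -> (forall i, g * f i = 0) ->
  exists2 r : R, r != 0 & forall i, r *: f i = 0.
Proof.
have [m] := ubnP (size g); elim: m g => // m IH g gm g0 gf.
have [lf|] := pselect (forall i, lead_coef g *: f i = 0).
  by exists (lead_coef g); rewrite ?lead_coef_eq0.
move=> /existsNP[i /eqP lfi].
have ex : exists j, (f i)`_j *: g != 0.
  apply: contrapT => nex; case/eqP: lfi; apply/polyP => j; rewrite coefZ coef0.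
  have [fg0|fg0] := eqVneq ((f i)`_j *: g) 0; last by case: nex; exists j.
  by rewrite mulrC /lead_coef -coefZ fg0 coef0.
have ub j : (f i)`_j *: g != 0 -> (j <= size (f i))%N.
  by apply: contraNT; rewrite -ltnNge => /ltnW/(nth_default 0) ->; rewrite scale0r.
case: (ex_maxnP ex ub) => j fj0 j_max.
apply: (IH ((f i)`_j *: g)) => //; last by move=> l; rewrite -scalerAl gf scaler0.
have sg : (0 < size g)%N by rewrite size_poly_gt0.
have : (size ((f i)`_j *: g) <= (size g).-1)%N.
  apply/leq_sizeP => l; rewrite leq_eqVlt => /orP[/eqP <-|gl]; last first.
    by rewrite coefZ [g`_l]nth_default ?mulr0 // -(prednK sg).
  have := congr1 (fun p : {poly R} => p`_(j + (size g).-1)) (gf i).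
  rewrite mulrC coefM coef0 coefZ => g0j; rewrite -[RHS]g0j.
  have jlt : (j < (j + (size g).-1).+1)%N by rewrite ltnS leq_addr.
  rewrite (bigD1 (Ordinal jlt)) //= addKn big1 ?addr0 // => -[s slt] /=.
  rewrite -val_eqE /= => sj; have [lt_sj|lt_js|e] := ltngtP s j; last by rewrite e eqxx in sj.
    rewrite [g`_ _]nth_default ?mulr0 // -(prednK sg) -(ltn_add2l s) subnKC; last first.
      by rewrite -ltnS.
    by rewrite ltn_add2r.
  have [fs0|/j_max] := eqVneq ((f i)`_s *: g) 0; last by rewrite leqNgt lt_js.
  by rewrite -coefZ fs0 coef0.
by rewrite -ltnS (prednK sg) => /leq_trans; apply.
Qed.

(** Powers of [X] place the coefficients of the [f i] in disjoint blocks of length [k], so a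
    constant killing the sum kills every [f i]; McCoy's theorem reduces to constants. *)
Lemma regular_combination n (f : 'I_n -> {poly R}) :
  (forall r : R, (forall i, r *: f i = 0) -> r = 0) ->
  exists u : 'I_n -> {poly R}, GRing.lreg (\sum_i u i * f i).
Proof.
move=> f_dense; pose k := \max_i size (f i).
exists (fun i => 'X^(k * i)); set g := \sum_i _.
have fk i : (size (f i) <= k)%N by exact: (@leq_bigmax _ (fun i => size (f i))).
have gE (i : 'I_n) j : (j < k)%N -> g`_(k * i + j) = (f i)`_j.
  move=> jk; rewrite coef_sum (bigD1 i) //= coefXnM ltnNge leq_addr addKn.
  rewrite big1 ?addr0 // => l li; rewrite coefXnM; case: ltnP => // le_l.
  have [lt_li|lt_il|/val_inj e] := ltngtP l i; last by rewrite e eqxx in li.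
    rewrite nth_default // (leq_trans (fk l)) // -(leq_add2l (k * l)).
    rewrite subnKC // -mulnSr (leq_trans _ (leq_addr _ _)) // leq_mul2l lt_li orbT //.
  suff : (k * i + j < k * l)%N by rewrite ltnNge le_l.
  by rewrite (@leq_trans (k * i.+1)) ?leq_mul2l ?lt_il ?orbT // mulnSr ltn_add2l.
apply: lreg_of_annihilator => h hg; apply/eqP/negPn/negP => h0.
have [|r /eqP r0 rg] := @McCoy 1 (fun=> g) h h0; first by [].
apply/r0/f_dense => i; apply/polyP => j; rewrite coef0 coefZ.
have [jk|kj] := ltnP j k; first by rewrite -gE // -coefZ (rg ord0) coef0.
by rewrite [_`_j]nth_default ?mulr0 // (leq_trans (fk i)).
Qed.
End McCoy.

Section TotalQuotientTheory.
Variable S : comNzRingType.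
Local Notation T := (total_quotient S).

Local Notation frac a sP := (\pi_T%qT (@TotalQuotient.mkfrac S a _ sP)).

Definition total_frac (a : S) : T := frac a (@GRing.lreg1 S).

Lemma frac_add a s (sP : GRing.lreg s) b t (tP : GRing.lreg t) :
  frac a sP + frac b tP = frac (a * t + b * s) (GRing.lregM sP tP).
Proof. by apply: etrans (esym (TotalQuotient.pi_add _ _)) _; apply/congr1/val_inj. Qed.

Lemma frac_opp a s (sP : GRing.lreg s) : - frac a sP = frac (- a) sP.
Proof. by apply: etrans (esym (TotalQuotient.pi_opp _)) _; apply/congr1/val_inj. Qed.

Lemma frac_mul a s (sP : GRing.lreg s) b t (tP : GRing.lreg t) :
  frac a sP * frac b tP = frac (a * b) (GRing.lregM sP tP).
Proof. by apply: etrans (esym (TotalQuotient.pi_mul _ _)) _; apply/congr1/val_inj. Qed.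

Lemma eq_fracP a s (sP : GRing.lreg s) b t (tP : GRing.lreg t) :
  frac a sP = frac b tP <-> a * t = b * s.
Proof. by split=> [/eqmodP/eqP|ab]; [|apply/eqmodP/eqP]. Qed.

Fact total_frac_is_zmod_morphism : zmod_morphism total_frac.
Proof.
by move=> a b; rewrite /total_frac frac_opp frac_add; apply/eq_fracP; rewrite !mulr1.
Qed.

Fact total_frac_is_monoid_morphism : monoid_morphism total_frac.
Proof.
split=> [|a b]; last by rewrite /total_frac frac_mul; apply/eq_fracP; rewrite !mulr1.
by rewrite -[RHS]/(TotalQuotient.one S) piE; apply: TotalQuotient.eq_frac.
Qed.

HB.instance Definition _ :=
  GRing.isZmodMorphism.Build S T total_frac total_frac_is_zmod_morphism.
HB.instance Definition _ :=
  GRing.isMonoidMorphism.Build S T total_frac total_frac_is_monoid_morphism.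

Lemma total_frac_eq0 a : total_frac a = 0 -> a = 0.
Proof.
by rewrite -[0](rmorph0 (total_frac : {rmorphism S -> T})) => /eq_fracP; rewrite mul0r mulr1.
Qed.

Lemma total_frac_unit s : GRing.lreg s -> exists u, u * total_frac s = 1.
Proof.
move=> sP; exists (frac 1 sP).
rewrite frac_mul -[RHS](rmorph1 (total_frac : {rmorphism S -> T})).
apply/eq_fracP.
by rewrite mul1r !mulr1 mul1r.
Qed.

Lemma total_frac_denom t : exists s a, GRing.lreg s /\ t * total_frac s = total_frac a.
Proof.
rewrite -[t]reprK; case: (repr t) => -[a s] sP.
have sP' : GRing.lreg s by apply/asboolP.
exists s, a; split=> //; have -> : TotalQuotient.Fraction sP = TotalQuotient.mkfrac a sP'.
  exact: val_inj.
by rewrite frac_mul; apply/eq_fracP; rewrite !mulr1.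
Qed.

Lemma total_frac_common_denom n (t : 'I_n -> T) :
  exists s (a : 'I_n -> S), GRing.lreg s /\ forall i, t i * total_frac s = total_frac (a i).
Proof.
have /choice[s /choice[a sP]] := fun i => total_frac_denom (t i).
exists (\prod_i s i), (fun i => a i * \prod_(j | j != i) s j); split=> [|i].
  by apply: big_ind => [||i _]; [exact: GRing.lreg1 | exact: GRing.lregM | case: (sP i)].
by rewrite (bigD1 i) //= !rmorphM mulrA; have [_ ->] := sP i.
Qed.

Lemma total_frac_flat (A : comNzRingType) (phi : {rmorphism A -> S}) :
  flat_morphism phi -> flat_morphism (total_frac \o phi : {rmorphism A -> T}).
Proof.
have mapE m n (X : 'M[A]_(m, n)) :
    map_mx (total_frac \o phi : {rmorphism A -> T}) X = map_mx total_frac (map_mx phi X).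
  by apply/matrixP => i j; rewrite !mxE.
move=> phi_flat p q M w; rewrite mapE => wM.
have [s [a [s_reg wE]]] := total_frac_common_denom (fun i => w 0 i).
have wE' : total_frac s *: w = map_mx total_frac (\row_i a i).
  by apply/rowP => i; rewrite !mxE mulrC wE.
have [|m [u [L [LM aL]]]] := phi_flat p q M (\row_i a i).
  apply/matrixP => i j; rewrite [RHS]mxE; apply: total_frac_eq0.
  have := congr1 (fun X : 'rV[T]_q => (total_frac s *: X) i j) wM.
  by rewrite /= scalemxAl wE' -map_mxM scaler0 [LHS]mxE [RHS]mxE.
have [v vs] := total_frac_unit s_reg.
exists m, (v *: map_mx total_frac u), L; split=> //.
rewrite mapE -scalemxAl -map_mxM -aL -wE' scalerA vs scale1r //.
Qed.
End TotalQuotientTheory.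

Section PolynomialTotalQuotient.
Variable R : comNzRingType.
Local Notation S := {poly R}.
Local Notation T := (total_quotient S).

Lemma id_flat (A : comNzRingType) : flat_morphism (idfun : {rmorphism A -> A}).
Proof.
move=> p q M w; rewrite map_mx_id => [wM|//]; exists 1%N, 1%:M, w; split=> //.
by rewrite map_mx_id // mul1mx.
Qed.

(** The degree [j] coefficients of [w] form a relation over [R], and [w] combines these relations
    with the powers of [X]. *)
Lemma polyC_flat : flat_morphism (polyC : {rmorphism R -> S}).
Proof.
move=> p q M w wM; pose m := (\max_i size (w 0%R i))%N.
have wm i : (size (w 0%R i) <= m)%N by exact: (@leq_bigmax _ (fun i => size (w 0%R i))).
exists m, (\row_j 'X^j), (\matrix_(j, i) (w 0 i)`_j); split.
  apply/matrixP => j l; have := congr1 (fun X : 'rV[S]_q => (X 0 l)`_j) wM.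
  rewrite !mxE coef0 coef_sum => wMj; rewrite -[RHS]wMj; apply: eq_bigr => i _.
  by rewrite !mxE coefMC.
apply/rowP => i; rewrite !mxE -[LHS](coefK) poly_def.
rewrite (big_ord_widen m (fun j => (w 0 i)`_j *: 'X^j)) // big_mkcond.
apply: eq_bigr => j _; rewrite !mxE mulrC mul_polyC.
by case: ltnP => // /(nth_default 0) ->; rewrite scale0r.
Qed.

Lemma poly_combination_unit n (f : 'I_n -> S) :
  (forall r : R, (forall i, r *: f i = 0) -> r = 0) ->
  exists t : 'I_n -> T, \sum_i t i * total_frac (f i) = 1.
Proof.
move=> /regular_combination[u /total_frac_unit[v v1]].
exists (fun i => v * total_frac (u i)); rewrite -v1 rmorph_sum mulr_sumr.
by apply: eq_bigr => i _; rewrite rmorphM mulrA.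
Qed.

Lemma base_inverts_Qideals :
  inverts_Qideals (@total_frac S \o polyC : {rmorphism R -> T}).
Proof.
move=> J /Qideal_generators[n [a [a_dense aJ]]].
have [|t t1] := @poly_combination_unit n (fun i => (a i)%:P).
  by move=> r ra; apply: a_dense => i; apply/polyC_inj; rewrite polyCM mul_polyC.
by exists n, a, t.
Qed.

Lemma poly_inverts_Qideals : inverts_Qideals (@total_frac S : {rmorphism S -> T}).
Proof.
move=> J /Qideal_generators[n [f [f_dense fJ]]].
have [|t t1] := @poly_combination_unit n f.
  move=> r rf; apply/polyC_inj/f_dense => i; by rewrite mul_polyC.
by exists n, f, t.
Qed.

Lemma total_quotient_improper : fg_dense_improper T.
Proof.
move=> n t t_dense; have [s [f [s_reg tE]]] := total_frac_common_denom t.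
have [v vs] := total_frac_unit s_reg.
have [|u u1] := @poly_combination_unit n f.
  move=> r rf; apply/polyC_inj/total_frac_eq0/t_dense => i.
  rewrite -[t i]mulr1 -vs (mulrCA (t i)) tE mulrCA -rmorphM mul_polyC rf.
  by rewrite rmorph0 mulr0.
exists (fun i => u i * total_frac s); rewrite -u1; apply: eq_bigr => i _.
by rewrite -tE mulrCA mulrA [_ * u i]mulrC mulrAC.
Qed.
End PolynomialTotalQuotient.

(** * Annihilator splittings over R, R[x] and T(R[x]) *)

Section Splittings.
Variable R : comNzRingType.

(** Up to Q-torsion, [a] generates [S] and [b] generates [Ann S]. If [y] kills both families, then
    [y] lies in [Ann S] and kills it up to torsion, so [l * y] squares to 0 for [l] in some ideal of
    Q. *)
Lemma tauq_Noetherian_splits (S : R -> Prop) :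
  tauq_Noetherian R -> is_reduced R -> is_ideal S -> annihilator_splits S.
Proof.
move=> RN R_red [S0 SL].
have [||n [a [aS aP]]] := tauq_Noetherian_ideal (S := S) RN; [by []|by []|].
have [||m [b [bS bP]]] := tauq_Noetherian_ideal (S := fun z => forall y, S y -> z * y = 0) RN.
- by move=> y _; rewrite mul0r.
- by move=> u x y xS yS z Sz; rewrite mulrDl -mulrA xS // yS // mulr0 addr0.
have Qdense (L : ideal R) (x : R) : Qideal L -> (forall l, l \in L -> l * x = 0) -> x = 0.
  move=> /Qideal_generators[k [l [l_dense lL]]] Lx; apply: l_dense => i.
  by rewrite mulrC Lx.
pose pick (u : 'I_n -> R) (v : 'I_m -> R) (i : 'I_(n + m)) :=
  match fintype.split i with inl j => u j | inr j => v j end.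
exists (n + m)%N, (pick a b), (pick a (fun=> 0)), (pick (fun=> 0) b); split; last first.
  move=> i; rewrite /pick; case: fintype.split => j; split=> //.
  - by rewrite addr0.
  - by move=> y _; rewrite mul0r.
  - by rewrite add0r.
  - exact: bS.
move=> y yc.
have ya i : y * a i = 0 by have := yc (lshift m i); rewrite /pick (unsplitK (inl i)).
have yb i : y * b i = 0 by have := yc (rshift n i); rewrite /pick (unsplitK (inr i)).
have yS : forall x, S x -> y * x = 0.
  move=> x /aP[L LQ Lx]; apply: (Qdense L) => // l /Lx[c cx].
  rewrite mulrCA cx mulr_sumr big1 // => i _.
  by rewrite mulrCA ya mulr0.
have [L LQ Ly] := bP y yS; apply: (Qdense L) => // l /Ly[c cy]; apply: R_red.
by rewrite {1}cy mulr_suml big1 // => i _; rewrite mulrACA [b i * y]mulrC yb mulr0.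
Qed.

Hypothesis R_splits : forall S : R -> Prop, is_ideal S -> annihilator_splits S.

(** The splitting is applied to the ideal of all coefficients of members of [S]. The [f i] having
    [x i] as a coefficient, together with the constants [z i], are dense: by McCoy a common
    annihilator may be taken constant, and it then kills every [c i]. *)
Lemma poly_splits (S : {poly R} -> Prop) : is_ideal S -> annihilator_splits S.
Proof.
move=> [S0 SL].
have [|n [c [x [z [c_dense cP]]]]] := R_splits (S := fun r => exists f i, S f /\ f`_i = r).
  split; first by exists 0, 0%N; rewrite coef0.
  move=> a _ _ [f [i [Sf <-]]] [g [j [Sg <-]]].
  (* The two shifts bring both chosen coefficients to degree [i + j]. *)
  exists ((a *: 'X^j) * f + 'X^i * g), (i + j)%N; split.
    by apply: (SL) => //; rewrite -['X^i * g]addr0; apply: (SL).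
  by rewrite coefD -scalerAl coefZ !coefXnM addKn addnK !ltnNge leq_addr leq_addl.
have /choice[f fP] : forall i, exists f, S f /\ exists j, f`_j = x i.
  by move=> i; have [_ [f [j [Sf fx]]] _] := cP i; exists f; split=> //; exists j.
pose c2 (b : bool) i := if b then f i else (z i)%:P.
pose idx (i : 'I_(n + n)) :=
  match fintype.split i with inl j => (true, j) | inr j => (false, j) end.
exists (n + n)%N, (fun i => c2 (idx i).1 (idx i).2),
  (fun i => if (idx i).1 then f (idx i).2 else 0),
  (fun i => if (idx i).1 then 0 else (z (idx i).2)%:P); split; last first.
  move=> i; rewrite /c2; case: (idx i) => -[] j /=; split=> //.
  - by rewrite addr0.
  - by have [] := fP j.
  - by move=> y _; rewrite mul0r.
  - by rewrite add0r.
  - move=> y Sy; apply/polyP => l; rewrite coefCM coef0.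
    by have [_ _ -> //] := cP j; exists y, l.
move=> y yc; apply/eqP/negPn/negP => y0.
have [r /eqP r0 rc] := McCoy y0 yc; apply/r0/c_dense => i.
have rf : r *: f i = 0 by have := rc (lshift n i); rewrite /idx (unsplitK (inl i)).
have rz : r *: (z i)%:P = 0 by have := rc (rshift n i); rewrite /idx (unsplitK (inr i)).
have [-> _ _] := cP i; have [_ [j <-]] := fP i.
rewrite mulrDr -coefZ rf coef0 add0r; apply: polyC_inj.
by rewrite polyCM mul_polyC rz.
Qed.

(** The dense family obtained for the contraction of [S] to R[x] generates the unit ideal of [T], so
    1 itself lies in [S + Ann S]. *)
Lemma total_quotient_splits (S : total_quotient {poly R} -> Prop) :
  is_ideal S -> annihilator_splits S.
Proof.
move=> [S0 SL].
have [|n [c [x [z [c_dense cP]]]]] :=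
    poly_splits (S := fun f : {poly R} => S (@total_frac {poly R} f)).
  split; first by rewrite rmorph0.
  by move=> a f g Sf Sg; rewrite rmorphD rmorphM; apply: (SL).
have [|t t1] := @poly_combination_unit R n c.
  by move=> r rc; apply/polyC_inj/c_dense => i; rewrite mul_polyC.
exists 1%N, (fun=> 1), (fun=> \sum_i t i * total_frac (x i)),
  (fun=> \sum_i t i * total_frac (z i)).
split=> [y /(_ ord0)|_]; first by rewrite mulr1.
split.
- rewrite -big_split -t1; apply: eq_bigr => i _ /=.
  by have [-> _ _] := cP i; rewrite rmorphD mulrDr.
- apply: big_ind => [//|u v Su Sv|i _]; first by rewrite -[u]mul1r; apply: (SL).
  by rewrite -[t i * _]addr0; apply: (SL) => //; have [] := cP i.
- move=> y Sy; rewrite mulr_suml big1 // => i _.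
  have [s [a [/total_frac_unit[v vs] ya]]] := total_frac_denom y.
  have Sa : S (total_frac a) by rewrite -ya mulrC -[_ * y]addr0; apply: (SL).
  have [_ _ za] := cP i; rewrite -mulrA -[y]mulr1 -vs [v * _]mulrC (mulrA y) ya.
  by rewrite (mulrA (total_frac _)) -rmorphM za // rmorph0 mul0r mulr0.
Qed.

Lemma poly_reduced : is_reduced R -> is_reduced {poly R}.
Proof.
move=> R_red f ff; apply/eqP; rewrite -lead_coef_eq0; apply/eqP/R_red/eqP/negPn/negP => lf.
by have := lead_coef_proper_mul lf; rewrite ff lead_coef0 => /eqP; rewrite eq_sym (negbTE lf).
Qed.

Lemma total_quotient_reduced (S : comNzRingType) :
  is_reduced S -> is_reduced (total_quotient S).
Proof.
move=> S_red t tt; have [s [a [/total_frac_unit[v vs] ta]]] := total_frac_denom t.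
have a0 : a = 0.
  by apply/S_red/total_frac_eq0; rewrite rmorphM /= -ta mulrACA tt mul0r.
by rewrite -[t]mulr1 -vs mulrCA ta a0 rmorph0 mulr0.
Qed.
End Splittings.

(** * Infinite dimension in the nonreduced case, and the theorem *)

(** One statement serves [A = R], R[x] and [T]: the complex always comes from [a] over [R] through
    [theta], while [b] is its counterpart in [A]. Regularity would give
    [theta a = theta a * u * theta a], which is 0 since [a * a = 0]. *)
Lemma gldim_wrt_infinite (R A T : comNzRingType) (theta : {rmorphism R -> T})
    (phi : {rmorphism A -> T}) (X : lmodType A -> Prop) (a : R) (b : A) :
  tauq_Noetherian R -> flat_morphism theta -> inverts_Qideals theta ->
  flat_morphism phi -> fg_dense_improper T -> phi b = theta a ->
  (forall P, X P -> forall N : lmodType T, Ext1_vanishes P (restr phi N)) ->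
  a * a = 0 -> theta a <> 0 -> gldim_wrt X = None.
Proof.
move=> RN theta_flat theta_inv phi_flat improper ba XExt aa ta0.
case E : (gldim_wrt X) => [d|//]; case: ta0.
have [k [D [D_complex D_exact D0 D_reg]]] := principal_resolution RN theta_flat theta_inv a.
have [|u ->] := D_reg.
  apply: (finite_dimension_regular (a := b) phi_flat D_complex D_exact _ improper XExt).
    by rewrite ba.
  exact: gldim_wrt_finite E.
by rewrite mulrAC -rmorphM aa rmorph0 mul0r.
Qed.

Theorem theorem3p14 (R : comNzRingType) :
  tauq_Noetherian R ->
  tauq_gldim R = tauq_gldim {poly R} /\
  tauq_gldim {poly R} = gldim (total_quotient {poly R}).
Proof.
move=> RN; have [R_red|] := pselect (is_reduced R).
  have R_splits (S : R -> Prop) : is_ideal S -> annihilator_splits S.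
    exact: tauq_Noetherian_splits.
  have -> : tauq_gldim R = Some 0%N.
    by apply: gldim_wrt_eq0 => M; apply: reduced_tauq_projective.
  have -> : tauq_gldim {poly R} = Some 0%N.
    apply: gldim_wrt_eq0 => M; apply: reduced_tauq_projective => [|S].
      exact: poly_reduced.
    exact: poly_splits.
  have -> // : gldim (total_quotient {poly R}) = Some 0%N.
  apply: gldim_wrt_eq0 => M; apply: reduced_improper_projective => [|S|].
  - exact/total_quotient_reduced/poly_reduced.
  - exact: total_quotient_splits.
  - exact: total_quotient_improper.
move=> /existsNP[a /not_implyP[aa a0]].
pose T := total_quotient {poly R} : comNzRingType.
pose iota := @total_frac {poly R} : {rmorphism {poly R} -> T}.
pose theta := iota \o polyC : {rmorphism R -> T}.
have theta_flat : flat_morphism theta := total_frac_flat (@polyC_flat R).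
have theta_inv : inverts_Qideals theta := @base_inverts_Qideals R.
have theta_a : theta a <> 0 by move=> /total_frac_eq0/polyC_inj.
have improper : fg_dense_improper T := @total_quotient_improper R.
have lucas (A : comNzRingType) (phi : {rmorphism A -> T}) : inverts_Qideals phi ->
    forall P, tauq_projective P -> forall N : lmodType T, Ext1_vanishes P (restr phi N).
  by move=> phi_inv P PP N; apply/Ext1_vanishesP/PP/restr_strongly_Lucas.
have -> : tauq_gldim R = None.
  exact: (gldim_wrt_infinite RN theta_flat theta_inv theta_flat improper erefl
           (lucas _ _ theta_inv) aa).
have -> : tauq_gldim {poly R} = None.
  have iota_flat : flat_morphism iota := total_frac_flat (@id_flat {poly R}).
  have iota_inv : inverts_Qideals iota := @poly_inverts_Qideals R.
  exact: (gldim_wrt_infinite (b := a%:P) RN theta_flat theta_inv iota_flat improper erefl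
           (lucas _ _ iota_inv) aa).
have -> // : gldim (total_quotient {poly R}) = None.
apply: (gldim_wrt_infinite (b := theta a) (phi := idfun) RN theta_flat theta_inv _
          improper erefl _ aa theta_a); first exact: id_flat.
by move=> P PP N; apply: projective_Ext1.
Qed.
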